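(* Let $\bm{T}$ be a $\bm{\sigma}$-Galton--Watson tree with type set $\mathfrak{G}$, and fix a type $\kappa\in\mathfrak{G}$. Let $(\mathcal{E}_n)_n$ be a family of events with $\mathbb{P}(\mathcal{E}_n)>0$ for all $n$, and let $\bm{T}_n := (\bm{T}\mid \mathcal{E}_n)$ be the tree $\bm{T}$ conditioned on $\mathcal{E}_n$. Suppose that there is a deterministic sequence $s_n\to\infty$ such that for all $\epsilon>0$ $$\exp(-\epsilon s_n)=o(\mathbb{P}(\mathcal{E}_n))\qquad\text{and}\qquad \mathbb{P}(\#_\kappa\bm{T}_n\ge s_n)\to 1 .$$ Then for any finite $\mathfrak{G}$-type plane tree $T$ whose root has type $\kappa$, $$\frac{N_T(\bm{T}_n)}{\#_\kappa\bm{T}_n}\xrightarrow{\;p\;}\mathbb{P}(\bm{T}(\kappa)=T).$$ Moreover, let $f(\bm{T}_n,v_n^\kappa)$ denote the fringe subtree of $\bm{T}_n$ at a uniformly selected type $\kappa$ vertex $v_n^\kappa$ of $\bm{T}_n$. Then $$\mathfrak{L}(f(\bm{T}_n,v_n^\kappa)\mid\bm{T}_n)\xrightarrow{\;p\;}\mathfrak{L}(\bm{T}(\kappa)),$$ where the conditional law is regarded as a random Borel probability measure on the countable space of finite $\mathfrak{G}$-type plane trees with the discrete topology.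
   Context: All limits are as $n\to\infty$; $\xrightarrow{p}$ is convergence in probability; $\mathfrak{L}(\cdot)$ denotes laws and $\mathfrak{L}(\cdot\mid\cdot)$ conditional laws. Types and trees. $\mathfrak{G}$ is a countable non-empty set of types. A $\mathfrak{G}$-type plane tree is a rooted ordered tree, each vertex having finitely many children, together with an assignment of a type in $\mathfrak{G}$ to each vertex. $\#_iT$ is the number of vertices of type $i$ in $T$, and $\#T=\sum_{i}\#_iT$. The fringe subtree of $T$ at a vertex $v$ is the tree formed by $v$ and all its descendants. $N_T(\cdot)$ takes a finite $\mathfrak{G}$-type tree and returns the number of its vertices at which the fringe subtree equals $T$. Branching trees. $\bm{\sigma}=(\bm{\sigma}_i)_{i\in\mathfrak{G}}$ is an independent family of random finite words over $\mathfrak{G}$ (elements of $\bigcup_{n\ge0}\mathfrak{G}^n$). The $\bm{\sigma}$-Galton--Watson tree $\bm{T}$ is the random $\mathfrak{G}$-type plane tree whose root type is given by an independent random type $\alpha$, and in which each vertex of type $i$ independently receives an ordered list of children whose types are given by an independent copy of $\bm{\sigma}_i$. Standing assumptions: $\mathbb{P}(\#_i\bm{T}\neq 0)>0$ for all $i\in\mathfrak{G}$, and $\bm{T}$ is almost surely finite. $\bm{T}(\kappa)$ denotes a $\bm{\sigma}$-Galton--Watson tree started at a root of type $\kappa$. *)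

(* Defs.v *)
From HB Require Import structures.
From mathcomp Require Import all_boot all_order all_algebra finmap.
From mathcomp Require Import all_classical all_reals all_analysis.

Set Implicit Arguments.
Unset Strict Implicit.
Unset Printing Implicit Defensive.

Import Order.TTheory GRing.Theory Num.Theory.
Import numFieldNormedType.Exports.
Local Open Scope classical_set_scope.
Local Open Scope ring_scope.

#[short(type="pcountType")]
HB.structure Definition PointedCountable := {T of Countable T & Pointed T}.

HB.instance Definition _ (T : countType) := isPointed.Build (seq T) [::].

(** [T] with the discrete topology, whose Borel sigma-algebra consists of all
    subsets of [T]. *)
Definition discr (T : Type) : Type := T.

HB.instance Definition _ (T : pcountType) := Countable.on (discr T).
HB.instance Definition _ (T : pcountType) := Pointed.on (discr T).
HB.instance Definition _ (T : pcountType) :=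
  @isMeasurable.Build default_measure_display (discr T) discrete_measurable
    discrete_measurable0 discrete_measurableC discrete_measurableU.
HB.instance Definition _ (T : pcountType) :=
  Topological.copy (discr T) (discrete_topology T).

Lemma discr_measurable (T : pcountType) (A : set (discr T)) : measurable A.
Proof. by []. Qed.

Definition discr_fun (T T' : Type) (f : T -> T') : discr T -> discr T' := f.

Lemma discr_fun_measurable (T T' : pcountType) (f : T -> T') :
  measurable_fun [set: discr T] (discr_fun f).
Proof. by []. Qed.

HB.instance Definition _ (T T' : pcountType) (f : T -> T') :=
  isMeasurableFun.Build _ _ (discr T) (discr T') (discr_fun f)
    (discr_fun_measurable f).

(** A [G]-type plane tree, finite or not, is given by its Ulam-Harris labelling:
    [t u] is the type of the vertex at address [u], or [None] if there is no such
    vertex. The root has address [[::]]; the children of [u], in order, have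
    addresses [rcons u 0], [rcons u 1], ... *)
Definition ptree (G : Type) := seq nat -> option G.

Section ptree.
Variable G : choiceType.
Implicit Types (t : ptree G) (u : seq nat) (i : G).

Definition vertices t : set (seq nat) := [set u | t u != None].

Definition typed_vertices i t : set (seq nat) := [set u | t u = Some i].

Definition finite_tree t : Prop := finite_set (vertices t).

(** 0 by convention if there are infinitely many such vertices. *)
Definition nb_type i t : nat := #|` fset_set (typed_vertices i t)|.

Definition fringe t u : ptree G := fun v => t (u ++ v).

End ptree.

Inductive ftree (G : Type) : Type := FNode of G & seq (ftree G).

Definition root_type (G : Type) (T : ftree G) : G := let: FNode i _ := T in i.

(** The Ulam-Harris labelling, embedding finite trees into [ptree G]. *)
Fixpoint lab (G : Type) (T : ftree G) : ptree G := fun u =>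
  let: FNode i Ts := T in
  if u is k :: v then nth (fun=> None) (map (@lab G) Ts) k v else Some i.

Section ftree_countable.
Variable G : Type.

Fixpoint ftree_enc (T : ftree G) : GenTree.tree G :=
  let: FNode i Ts := T in GenTree.Node 0 (GenTree.Leaf i :: map ftree_enc Ts).

Fixpoint ftree_dec (s : GenTree.tree G) : option (ftree G) :=
  match s with
  | GenTree.Node _ (GenTree.Leaf i :: ss) =>
      Some (FNode i (pmap id (map ftree_dec ss)))
  | _ => None
  end.

Lemma ftree_encK : pcancel ftree_enc ftree_dec.
Proof.
rewrite /pcancel; fix IH 1; case=> i Ts /=; congr (Some (FNode i _)).
by elim: Ts => [//|T Ts IHs] /=; rewrite IH /= IHs.
Qed.

End ftree_countable.

HB.instance Definition _ (G : countType) :=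
  Countable.copy (ftree G) (pcan_type (@ftree_encK G)).
HB.instance Definition _ (G : pcountType) :=
  isPointed.Build (ftree G) (FNode point [::]).

(** The finite tree whose labelling is [t]; a dummy value if [t] is infinite. *)
Definition ftree_of (G : pcountType) (t : ptree G) : ftree G :=
  xget point [set T | lab T = t].

(** 0 by convention if the fringe subtree equals [T] at infinitely many vertices. *)
Definition nb_fringe (G : choiceType) (T : ftree G) (t : ptree G) : nat :=
  #|` fset_set [set u | vertices t u /\ fringe t u = lab T]|.

(** The tree below a vertex of type [i] at address [u], when any vertex with type
    [j] and address [v] receives children with types given by the word [w v j]. *)
Fixpoint tree_from (G : Type) (w : seq nat -> G -> seq G) (u : seq nat) (i : G)
    (v : seq nat) : option G :=
  if v is k :: v' then
    if onth (w u i) k is Some j then tree_from w (rcons u k) j v' else None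
  else Some i.

(** The tree with root type [i] and offspring words [w]. *)
Definition gw_tree (G : Type) (w : seq nat -> G -> seq G) (i : G) : ptree G :=
  tree_from w [::] i.

Definition mutually_independent d (Omega : measurableType d) (R : realType)
    (P : probability Omega R) (I : choiceType)
    (F : I -> set_system Omega) : Prop :=
  forall (J : {fset I}) (A : I -> set Omega),
    (forall j, j \in J -> F j (A j)) ->
    P (\bigcap_(j in [set` J]) A j) = (\prod_(j <- J) P (A j))%E.

Definition rv_events d d' (Omega : measurableType d) (T : measurableType d')
    (X : Omega -> T) : set_system Omega :=
  preimage_set_system setT X measurable.

Section galton_watson.
Context d (Omega : measurableType d) (R : realType) (P : probability Omega R).
Context (G : pcountType).
Variables (alpha : {RV P >-> discr G})
  (xi : seq nat -> G -> {RV P >-> discr (seq G)}).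

Definition gw_events (o : option (seq nat * G)) : set_system Omega :=
  if o is Some (u, i) then rv_events (xi u i) else rv_events alpha.

(** [alpha] and all the [xi u i] are independent, and for each address [u] the
    family [xi u] is a copy of the independent family [sigma]. *)
Definition gw_source d0 (Omega0 : measurableType d0) (Q : probability Omega0 R)
    (sigma : G -> {RV Q >-> discr (seq G)}) : Prop :=
  [/\ mutually_independent Q (fun i => rv_events (sigma i)),
      mutually_independent P gw_events
    & forall u i A, distribution P (xi u i) A = distribution Q (sigma i) A].

(** The tree started at a root of type [i]. All of these trees are built from the
    same offspring words, but only their individual laws matter. *)
Definition gw_at (i : G) (omega : Omega) : ptree G :=
  gw_tree (fun u j => xi u j omega) i.

(** The tree with random root type [alpha]. *)
Definition gw (omega : Omega) : ptree G := gw_at (alpha omega) omega.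

Definition gw_at_ftree (i : G) (omega : Omega) : discr (ftree G) :=
  ftree_of (gw_at i omega).

Let measurable_const_set (p : Prop) : measurable [set _ : Omega | p].
Proof.
have [pT|pF] := pselect p.
  rewrite (_ : [set _ | _] = setT); first exact: measurableT.
  by apply/seteqP; split.
rewrite (_ : [set _ | _] = set0); first exact: measurable0.
by apply/seteqP; split.
Qed.

Lemma measurable_gw_at_label (i : G) (v : seq nat) (o : option G) :
  measurable [set omega | gw_at i omega v = o].
Proof.
rewrite /gw_at /gw_tree; elim: v [::] i => [|k v IH] u i /=.
  exact: measurable_const_set.
have mxi (p : option G) : measurable [set omega | onth (xi u i omega) k = p].
  rewrite -[X in measurable X]setTI.
  exact: (measurable_funPT (xi u i) measurableT
    [set w : discr (seq G) | onth w k = p]).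
rewrite (_ : [set _ | _] = \bigcup_(p in [set: option G])
    ([set omega | onth (xi u i omega) k = p] `&`
     [set omega | (if p is Some j then
       tree_from (fun u j => xi u j omega) (rcons u k) j v else None) = o])).
  apply: countable_bigcupT_measurable => [|p]; first exact: countableP.
  apply: measurableI => //.
  case: p => [j|]; first exact: IH.
  exact: measurable_const_set.
apply/seteqP; split=> omega /= => [H|[p _ [<-]]//].
by exists (onth (xi u i omega) k).
Qed.

Lemma measurable_gw_at_eq (i : G) (t : ptree G) :
  measurable [set omega | gw_at i omega = t].
Proof.
rewrite (_ : [set _ | _] =
    ~` \bigcup_(v in [set: seq nat]) ~` [set omega | gw_at i omega v = t v]).
  apply: measurableC; apply: countable_bigcupT_measurable => [|v].
    exact: countableP.
  exact/measurableC/measurable_gw_at_label.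
apply/seteqP; split=> omega /=; first by move=> <- [v _]; apply.
by move=> H; apply/funext => v; apply: contrapT => Hv; apply: H; exists v.
Qed.

Lemma measurable_gw_at_ftree (i : G) :
  measurable_fun [set: Omega] (gw_at_ftree i).
Proof.
move=> _ B _; rewrite setTI.
pose C (T : ftree G) := [set omega | gw_at i omega = lab T].
have mC T : measurable (C T) by exact: measurable_gw_at_eq.
rewrite (_ : _ @^-1` _ =
    (\bigcup_(T in [set: ftree G]) (C T `&` [set _ | B (ftree_of (lab T))])) `|`
    (~` (\bigcup_(T in [set: ftree G]) C T) `&` [set _ | B (point : ftree G)])).
  apply: measurableU.
    apply: countable_bigcupT_measurable => [|T]; first exact: countableP.
    by apply: measurableI; [exact: mC|exact: measurable_const_set].
  apply: measurableI; last exact: measurable_const_set.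
  apply: measurableC.
  by apply: countable_bigcupT_measurable => [|T]; first exact: countableP.
have ftree_ofN omega : ~ (\bigcup_(T in [set: ftree G]) C T) omega ->
    gw_at_ftree i omega = point.
  move=> H; rewrite /gw_at_ftree /ftree_of xgetPN // => T HT.
  by apply: H; exists T.
apply/seteqP; split=> omega /=.
- move=> BT; have [H|H] := pselect ((\bigcup_(T in [set: ftree G]) C T) omega).
    left; case: H => T _ CT; exists T => //; split => //=.
    by move: BT; rewrite /gw_at_ftree CT.
  by right; split => //=; rewrite -(ftree_ofN _ H).
- case=> [[T _ [CT /=]]|[H]]; first by rewrite /gw_at_ftree CT.
  by rewrite (ftree_ofN _ H).
Qed.

HB.instance Definition _ (i : G) :=
  isMeasurableFun.Build _ _ Omega (discr (ftree G)) (gw_at_ftree i)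
    (measurable_gw_at_ftree i).

End galton_watson.

(** The conditional probability [P(. | E)]. When [P E = 0], it is [P] by
    convention. *)
Definition cond_probability d (Omega : measurableType d) (R : realType)
    (P : probability Omega R) (E : set Omega) (mE : measurable E) :
    probability Omega R :=
  mnormalize (mrestr P mE) P.

(** Convergence in probability to a constant [x] of random elements [X n] of a
    topological space, where the law of [X n] is taken under [P n]. *)
Definition cvg_in_probability d (Omega : measurableType d) (R : realType)
    (P : nat -> probability Omega R) (S : topologicalType)
    (X : nat -> Omega -> S) (x : S) : Prop :=
  forall U : set S, open_nbhs x U ->
    (fun n => P n [set omega | U (X n omega)]) @ \oo --> 1%E.

Definition bounded_continuous (T : topologicalType) (R : realType) :=
  {f : T -> R | continuous f /\ exists M : R, forall x, `|f x| <= M}.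

(** The space of Borel probability measures on [discr T] with the weak topology:
    the coarsest one for which the integral of every bounded continuous function
    is continuous. *)
Definition prob_space (T : pcountType) (R : realType) : topologicalType :=
  initial_topology (fun (mu : probability (discr T) R) =>
    (fun f => \int[mu]_x (sval f x)) :
    {ptws bounded_continuous (discr T) R -> R}).

(** The law of a uniformly selected vertex of type [i] of [t], as a measure on
    addresses. It is a dummy Dirac mass if the number of these vertices is zero
    or infinite. *)
Definition uniform_vertex (R : realType) (G : choiceType) (i : G) (t : ptree G) :
    probability (discr (seq nat)) R :=
  mnormalize
    (mrestr counting
      (discr_measurable (typed_vertices i t : set (discr (seq nat)))))
    (dirac ([::] : discr (seq nat))).

(** For a given tree [t], the law of its fringe subtree at a uniformly selected
    vertex of type [i]. *)
Definition fringe_law (R : realType) (G : pcountType) (i : G) (t : ptree G) :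
    prob_space (ftree G) R :=
  distribution (uniform_vertex R i t)
    (discr_fun (fun u => ftree_of (fringe t u))).

(** The law of [gw_at xi i] on finite trees. The dummy value of [ftree_of] has no
    influence when [gw_at xi i] is almost surely finite. *)
Definition gw_law d (Omega : measurableType d) (R : realType)
    (P : probability Omega R) (G : pcountType)
    (xi : seq nat -> G -> {RV P >-> discr (seq G)}) (i : G) :
    prob_space (ftree G) R :=
  distribution P (gw_at_ftree xi i).

(* Main.v *)
Require Import Defs.
From mathcomp Require Import all_boot all_order all_algebra.
From mathcomp Require Import finmap.
From mathcomp Require Import all_classical all_reals all_analysis.
From mathcomp Require Import ring lra.

Set Implicit Arguments.
Unset Strict Implicit.
Unset Printing Implicit Defensive.

Import Order.TTheory GRing.Theory Num.Theory.
Import numFieldNormedType.Exports.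
Local Open Scope classical_set_scope.
Local Open Scope ring_scope.

(** The law of the tree gives mass [al (root_type t) * q t] to a finite tree [t],
    where [q t] is a product of offspring probabilities over the vertices of [t].
    Fix [T] with root type [kappa], put [p = q T], and write [N t] and [n t] for the
    numbers of fringe subtrees equal to [T] and of vertices of type [kappa]. If
    [b = 1 - p (a - 1)], then [a ^ N * b ^ n] has expectation at most 1 whatever the
    root type. Indeed, by induction on the height and conditionally on the first
    generation, the expectation from a root of type [kappa] is at most
    [b + p (a - 1) = 1], because within [T] itself only the factors [b] occur below
    the root, and [b - 1] and [a - 1] have opposite signs. Taking [a] slightly above
    or below 1, Markov's inequality yields
    [P(n >= m, |N - p n| >= eps n) <= 2 exp(- c m)], which survives conditioning on
    events whose probability is not exponentially small in [s].

    For the conditional law of the fringe subtree, it remains to see that the tree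
    started at [kappa] is almost surely finite: otherwise every type from which
    [kappa] can be reached would produce infinite trees with positive probability. *)

(** * Plane trees *)

Section trees.
Variable G : pcountType.
Implicit Types (t T : ftree G) (Ts : seq (ftree G)) (i j : G) (u v : seq nat).

(** Children sit in a nested list, so induction needs a hypothesis on every member of that list. *)
Lemma ftree_mem_ind (C : ftree G -> Prop) :
  (forall i Ts, (forall T, T \in Ts -> C T) -> C (FNode i Ts)) -> forall t, C t.
Proof.
move=> IH; fix F 1; case=> i Ts; apply: IH.
elim: Ts => [|T Ts IHs] t; first by clear F.
rewrite inE => /orP[/eqP ->|]; [exact: F|exact: IHs].
Qed.

Definition children t : seq (ftree G) := let: FNode _ Ts := t in Ts.

Definition root_word t : seq G := map (@root_type G) (children t).

Fixpoint subtrees t : seq (ftree G) :=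
  let: FNode _ Ts := t in t :: flatten (map subtrees Ts).

Fixpoint sub t u : option (ftree G) :=
  let: FNode _ Ts := t in
  if u is k :: v then nth (fun=> None) (map sub Ts) k v else Some t.

(** Listed in the same depth-first order as [subtrees], so that the two lists match term by term. *)
Fixpoint addresses t : seq (seq nat) :=
  let: FNode _ Ts := t in
  [::] :: [seq k :: v | k <- iota 0 (size Ts), v <- nth [::] (map addresses Ts) k].

Lemma sub_nil t : sub t [::] = Some t.
Proof. by case: t. Qed.

Lemma sub_cons i Ts k v :
  sub (FNode i Ts) (k :: v) = if onth Ts k is Some T then sub T v else None.
Proof. by rewrite /=; elim: Ts k => [|T Ts IH] [|k] //=. Qed.

Lemma sub_cat t u v : sub t (u ++ v) = if sub t u is Some t' then sub t' v else None.
Proof.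
elim: u t => [|k u IH] t; first by rewrite sub_nil.
by case: t => i Ts; rewrite cat_cons !sub_cons; case: (onth Ts k).
Qed.

Lemma labE t u : lab t u = omap (@root_type G) (sub t u).
Proof.
elim: u t => [|k u IH] [i Ts] //=.
case: (ltnP k (size Ts)) => kTs.
  by rewrite !(nth_map (FNode i Ts))//.
by rewrite !nth_default ?size_map.
Qed.

Lemma fringe_lab t u t' : sub t u = Some t' -> fringe (lab t) u = lab t'.
Proof. by move=> tu; apply/funext => v; rewrite /fringe !labE sub_cat tu. Qed.

Lemma mem_addresses t u : (u \in addresses t) = (sub t u != None).
Proof.
elim: u t => [|k u IH] [i Ts]; first by rewrite in_cons eqxx.
rewrite [addresses _]/= in_cons /=.
case: (ltnP k (size Ts)) => kTs; last first.
  rewrite nth_default ?size_map//; apply/negbTE/negP.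
  move=> /allpairsPdep[l [v [+ _ [lk _]]]].
  by rewrite mem_iota add0n -lk ltnNge kTs.
rewrite (nth_map (FNode i Ts))// -IH.
apply/allpairsPdep/idP => [[l [v [_ vl [kl uv]]]]|uk].
  by move: vl; rewrite -kl -uv (nth_map (FNode i Ts)).
by exists k, u; rewrite mem_iota add0n kTs (nth_map (FNode i Ts)).
Qed.

Lemma addresses_uniq t : uniq (addresses t).
Proof.
elim/ftree_mem_ind: t => i Ts IH /=; apply/andP; split.
  by apply/negP => /allpairsPdep[l [v [_ _]]].
apply: allpairs_uniq_dep; first exact: iota_uniq.
  move=> k; rewrite mem_iota add0n => /= kTs.
  by rewrite (nth_map (FNode i Ts))// IH// mem_nth.
by move=> [k v] [l w] _ _ /= [-> ->].
Qed.

Lemma sub_addresses t : map (sub t) (addresses t) = map Some (subtrees t).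
Proof.
elim/ftree_mem_ind: t => i Ts IH.
rewrite [addresses _]/= [subtrees _]/= !map_cons; congr (_ :: _).
rewrite !map_flatten -!map_comp; congr flatten.
apply: (@eq_from_nth _ [::]) => [|k]; rewrite !size_map size_iota// => kTs.
rewrite (nth_map 0%N) ?size_iota// nth_iota// add0n (nth_map (FNode i Ts))//=.
rewrite (nth_map (FNode i Ts))// -IH ?mem_nth// -map_comp; apply: eq_map => v.
by rewrite /= (nth_map (FNode i Ts)).
Qed.

Lemma root_mem_subtrees t : t \in subtrees t.
Proof. by case: t => i Ts; rewrite inE eqxx. Qed.

(** The root label gives the type, the addresses of length one give the number of children, and
    induction handles each child. *)
Lemma lab_inj : injective (@lab G).
Proof.
elim/ftree_mem_ind => i Ts IH [j Ts'] eTs.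
have := congr1 (@^~ [::]) eTs => -[<-]; congr FNode.
have lab_nth k : (k < size Ts)%N -> (k < size Ts')%N ->
    lab (nth (FNode i Ts) Ts k) = lab (nth (FNode i Ts) Ts' k).
  move=> kT kT'; apply/funext => v.
  by have := congr1 (@^~ (k :: v)) eTs; rewrite /= !(nth_map (FNode i Ts)).
have sz (A B : seq (ftree G)) a b :
    lab (FNode a A) = lab (FNode b B) -> (size A <= size B)%N.
  move=> eAB; rewrite leqNgt; apply/negP => ltBA.
  have := congr1 (@^~ [:: size B]) eAB; rewrite /= (nth_map (FNode a A))//.
  by rewrite (@nth_default _ _ [seq lab T | T <- B]) ?size_map//; case: (nth _ _ _).
have eqs : size Ts = size Ts'.
  by apply/eqP; rewrite eqn_leq (sz _ _ _ _ eTs) (sz _ _ _ _ (esym eTs)).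
apply: (@eq_from_nth _ (FNode i Ts)) => // k kT.
by apply: IH; [exact: mem_nth|apply: lab_nth => //; rewrite -eqs].
Qed.

Lemma ftree_of_lab t : ftree_of (lab t) = t.
Proof.
by rewrite /ftree_of; apply: xget_unique => // T /lab_inj.
Qed.


Definition nb_root i t := count (fun t' => root_type t' == i) (subtrees t).
Definition nb_sub T t := count_mem T (subtrees t).

(** Turns cardinals of sets of addresses into counts over the list [subtrees], on which the weights
    are computed. *)
Lemma card_set_addresses t (p : ftree G -> bool) (S : set (seq nat)) :
  (forall u, S u <-> exists2 t', sub t u = Some t' & p t') ->
  #|` fset_set S| = count p (subtrees t).
Proof.
move=> SE; pose q u := if sub t u is Some t' then p t' else false.
have -> : count p (subtrees t) = size (seq.filter q (addresses t)).
  rewrite size_filter (_ : count q _ =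
    count (fun o => if o is Some t' then p t' else false)
      (map (sub t) (addresses t))).
    by rewrite sub_addresses count_map.
  by rewrite count_map.
have -> : S = [set` [fset u in seq.filter q (addresses t)]%fset].
  apply/seteqP; split => u /=; rewrite !inE/= mem_filter /q mem_addresses.
    by move=> /SE[t' -> ->].
  by case tu : (sub t u) => [t'|//] /andP[pt' _]; apply/SE; exists t'.
rewrite set_fsetK card_fseq undup_id//.
exact/seq.filter_uniq/addresses_uniq.
Qed.

Lemma typed_vertices_lab i t u :
  typed_vertices i (lab t) u <-> exists2 t', sub t u = Some t' & root_type t' == i.
Proof.
rewrite /typed_vertices /= labE; split.
  by case: (sub t u) => [t'|//] [<-]; exists t'.
by case=> t' -> /eqP <-.
Qed.

Lemma nb_type_lab i t : nb_type i (lab t) = nb_root i t.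
Proof. exact/card_set_addresses/typed_vertices_lab. Qed.

Lemma nb_fringe_lab T t : nb_fringe T (lab t) = nb_sub T t.
Proof.
apply: card_set_addresses => u; rewrite /vertices /= labE; split.
  case tu : (sub t u) => [t'|]; last by case.
  case=> _; rewrite (fringe_lab tu) => /lab_inj ->.
  by exists T.
by case=> t' tu /eqP <-; rewrite (fringe_lab tu) tu.
Qed.

Lemma nb_sub_le T t : (nb_sub T t <= nb_root (root_type T) t)%N.
Proof. by apply: sub_count => t' /eqP ->. Qed.

Lemma tree_from_lab (w : seq nat -> G -> seq G) u i t :
  tree_from w u i = lab t <->
  root_type t = i /\
  forall v t', sub t v = Some t' -> w (u ++ v) (root_type t') = root_word t'.
Proof.
elim/ftree_mem_ind: t u i => j Ts IH u i.
have nth_word k : onth (map (@root_type G) Ts) k = omap (@root_type G) (onth Ts k).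
  by rewrite onth_map.
split=> [e|[ri e]]; last first.
  have {ri} <- : j = i := ri.
  have e0 : w u j = map (@root_type G) Ts by rewrite -[u]cats0 (e [::] (FNode j Ts)).
  apply/funext => -[//|k v]; rewrite labE sub_cons /= e0 nth_word.
  case Tk : (onth Ts k) => [T|//] /=; rewrite -labE.
  suff -> : tree_from w (rcons u k) (root_type T) = lab T by [].
  apply/IH; first by apply/onthP; exists k.
  by split=> // v' t' Tv'; rewrite cat_rcons; apply: e; rewrite sub_cons Tk.
have {}e v : tree_from w u i v = lab (FNode j Ts) v by rewrite e.
have ji : j = i by have := e [::] => -[].
rewrite -{}ji {i} in e *; split => // v t'.
have e0 : w u j = map (@root_type G) Ts.
  apply/eq_from_onth => k.
  have := e [:: k]; rewrite labE sub_cons /= nth_word.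
  by case: (onth Ts k) (onth (w u j) k) => [T|] [i|]//=; rewrite sub_nil.
case: v => [[<-]|k v]; first by rewrite cats0.
rewrite sub_cons; case Tk : (onth Ts k) => [T|//] Tv.
have : tree_from w (rcons u k) (root_type T) = lab T.
  apply/funext => v'; have := e (k :: v').
  by rewrite labE sub_cons /= e0 nth_word Tk /= -labE.
move/IH => [|_ /(_ _ _ Tv)]; last by rewrite cat_rcons.
by apply/onthP; exists k.
Qed.

End trees.

(** * Exponential moments *)

Section finite_sums.
Variable R : realType.

Lemma sum_le_subseq (X : eqType) (f : X -> R) (K K' : seq X) :
  (forall x, 0 <= f x) -> uniq K -> {subset K <= K'} ->
  \sum_(x <- K) f x <= \sum_(x <- K') f x.
Proof.
move=> f0 + sub.
elim: K K' sub => [|x K IH] K' sub; first by rewrite big_nil sumr_ge0.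
move=> /= /andP[xK uK].
rewrite big_cons (perm_big _ (perm_to_rem (sub x (mem_head _ _)))) big_cons lerD2l.
apply: IH => // y yK.
have yx : y != x by apply: contraNneq xK => <-.
have : y \in K' by rewrite sub// inE yK orbT.
by rewrite (perm_mem (perm_to_rem (sub x (mem_head _ _)))) inE (negbTE yx).
Qed.

(** Conditioning on the value of [pi], which will be the root word or the root type of a tree. *)
Lemma sum_fibers_le (X Y : eqType) (pi : X -> Y) (f c : Y -> R) (g : X -> R)
    (K : seq X) :
  (forall y, 0 <= f y) ->
  (forall y, \sum_(x <- K | pi x == y) g x <= c y) ->
  \sum_(x <- K) f (pi x) * g x <= \sum_(y <- undup (map pi K)) f y * c y.
Proof.
move=> f0 gc.
rewrite (eq_big_seq (fun x => \sum_(y <- undup (map pi K) | pi x == y) f y * g x)).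
  rewrite (exchange_big_dep xpredT)//=; apply: ler_sum => y _.
  by rewrite -mulr_sumr ler_wpM2l.
move=> x xK; rewrite (eq_bigl (pred1 (pi x))) => [|y]; last by rewrite eq_sym.
by rewrite -big_filter filter_pred1_uniq ?undup_uniq ?mem_undup ?map_f// big_seq1.
Qed.

Lemma ler_prod_seq (X : eqType) (l : seq X) (f g : X -> R) :
  {in l, forall x, 0 <= f x <= g x} -> \prod_(x <- l) f x <= \prod_(x <- l) g x.
Proof. by move=> fg; rewrite big_seq [leRHS]big_seq; apply: ler_prod. Qed.

(** With [x = y - 2 * y ^+ 2], the bound [expR (- x) >= 1 - x > 0] reduces this to [(1 + y) * (1 -
    x) = 1 + y ^+ 2 * (1 + 2 * y) >= 1]. *)
Lemma expR_le1D (y : R) : - 2^-1 <= y -> expR (y - 2 * y ^+ 2) <= 1 + y.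
Proof.
move=> y2.
have := expR_ge1Dx (- (y - 2 * y ^+ 2)).
rewrite expRN; set e := expR _ => le_e.
have e0 : 0 < e by rewrite expR_gt0.
have le1 : e * (1 - (y - 2 * y ^+ 2)) <= 1.
  by rewrite mulrC -ler_pdivlMr// div1r.
have y3 : 1 <= (1 + y) * (1 - (y - 2 * y ^+ 2)).
  rewrite (_ : _ * _ = 1 + y ^+ 2 * (1 + 2 * y)); last by ring.
  by rewrite lerDl mulr_ge0 ?sqr_ge0//; lra.
have pos : 0 < 1 - (y - 2 * y ^+ 2).
  rewrite (_ : _ - _ = 2 * (y - 4^-1) ^+ 2 + 7 / 8); last by field.
  have := sqr_ge0 (y - 4^-1); lra.
by rewrite -(ler_pM2r pos) (le_trans le1).
Qed.

End finite_sums.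

(** * Tree weights for subprobability offspring laws, summed over duplicate-free finite lists *)

Section weights.
Variables (R : realType) (G : pcountType) (s : G -> seq G -> R).
Hypothesis s0 : forall i w, 0 <= s i w.
Hypothesis s1 : forall i K, uniq K -> \sum_(w <- K) s i w <= 1.
Implicit Types (t T : ftree G) (Ts : seq (ftree G)) (i j : G).

Definition tree_weight t : R :=
  \prod_(t' <- subtrees t) s (root_type t') (root_word t').

Lemma prod_subtrees (h : ftree G -> R) i Ts :
  \prod_(t' <- subtrees (FNode i Ts)) h t' =
  h (FNode i Ts) * \prod_(T <- Ts) \prod_(t' <- subtrees T) h t'.
Proof. by rewrite /= big_cons big_flatten big_map. Qed.

Lemma tree_weight_ge0 t : 0 <= tree_weight t.
Proof. exact: prodr_ge0. Qed.

Lemma tree_weight_node i Ts :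
  tree_weight (FNode i Ts) =
  s i (map (@root_type G) Ts) * \prod_(T <- Ts) tree_weight T.
Proof. exact: prod_subtrees. Qed.

(** Induction on [w]: the forests in [K] lie in the product of their list of first trees and their
    list of tails, over which the sum factorizes. *)
Lemma forest_sum_le (g : ftree G -> R) (c : G -> R) :
  (forall t, 0 <= g t) ->
  (forall i K, uniq K -> {in K, forall t, root_type t = i} ->
    \sum_(t <- K) g t <= c i) ->
  forall (w : seq G) (K : seq (seq (ftree G))), uniq K ->
    {in K, forall Ts, map (@root_type G) Ts = w} ->
  \sum_(Ts <- K) \prod_(T <- Ts) g T <= \prod_(i <- w) c i.
Proof.
move=> g0 gc.
have c0 i : 0 <= c i by rewrite (le_trans _ (gc i [::] _ _))// big_nil.
elim=> [|i w IH] K uK Kw.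
  have sub : {subset K <= [:: [::]]}.
    by move=> Ts /Kw/(congr1 size); rewrite size_map inE => /size0nil ->.
  apply: le_trans (sum_le_subseq _ uK sub) _; first by move=> Ts; apply: prodr_ge0.
  by rewrite big_seq1 !big_nil.
pose hd := undup (map (head point) K); pose tl := undup (map behead K).
have sub : {subset K <= [seq T :: Ts | T <- hd, Ts <- tl]}.
  move=> Ts TsK; have := Kw _ TsK; case: Ts TsK => // T Ts TTsK _.
  apply: allpairs_f; rewrite mem_undup.
    exact: (map_f (head point) TTsK).
  exact: (map_f behead TTsK).
apply: le_trans (sum_le_subseq _ uK sub) _; first by move=> Ts; apply: prodr_ge0.
rewrite big_allpairs_dep big_cons.
under eq_bigr => T _ do under eq_bigr => Ts _ do rewrite big_cons.
rewrite -[leLHS]big_distrlr/= ler_pM ?sumr_ge0//.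
- by move=> Ts _; apply: prodr_ge0.
- apply: gc; first exact: undup_uniq.
  by move=> t; rewrite mem_undup => /mapP[Ts /Kw + ->]; case: Ts => //= T Ts [].
- apply: IH; first exact: undup_uniq.
  by move=> t; rewrite mem_undup => /mapP[Ts /Kw + ->]; case: Ts => //= T Ts [].
Qed.

Lemma node_sum_le (g : ftree G -> R) (c : G -> R) i K :
  (forall t, 0 <= g t) ->
  (forall i K, uniq K -> {in K, forall t, root_type t = i} ->
    \sum_(t <- K) g t <= c i) ->
  uniq K -> {in K, forall t, root_type t = i} ->
  \sum_(t <- K) s i (root_word t) * \prod_(T <- children t) g T <=
  \sum_(w <- undup (map (@root_word G) K)) s i w * \prod_(j <- w) c j.
Proof.
move=> g0 gc uK Ki.
apply: (sum_fibers_le (pi := @root_word G) (f := s i)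
  (g := fun t => \prod_(T <- children t) g T)
  (c := fun w => \prod_(j <- w) c j)) => // w.
have := forest_sum_le g0 gc (w := w)
  (K := map (@children G) [seq t <- K | root_word t == w]).
rewrite big_map big_filter; apply.
  (* All trees of [K] have root type [i], hence are determined by their children. *)
  rewrite map_inj_in_uniq ?seq.filter_uniq// => -[i1 T1] [i2 T2].
  by rewrite !mem_filter => /andP[_ /Ki /= ->] /andP[_ /Ki /= ->] ->.
by move=> Ts /mapP[t]; rewrite mem_filter => /andP[/eqP <- _] ->.
Qed.

Section truncation.
Variables h g0 : ftree G -> R.
Hypothesis h0 : forall t, 0 <= h t.
Hypothesis g00 : forall t, 0 <= g0 t.

(** The weight [\prod h t' * s t'] over the vertices of depth less than [n], with
    the fringe subtrees at depth [n] weighted by [g0]. *)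
Fixpoint trunc_weight n t : R :=
  if n is n'.+1 then
    h t * (s (root_type t) (root_word t) *
    \prod_(T <- children t) trunc_weight n' T)
  else g0 t.

Lemma trunc_weight_ge0 n t : 0 <= trunc_weight n t.
Proof.
elim: n t => [|n IH] t //=.
by rewrite !mulr_ge0// prodr_ge0.
Qed.

(** Once [n] exceeds the height of [t], the truncation depth is never reached. *)
Lemma trunc_weight_stable t : exists N, forall n, (N <= n)%N ->
  trunc_weight n t =
  \prod_(t' <- subtrees t) (h t' * s (root_type t') (root_word t')).
Proof.
elim/ftree_mem_ind: t => i Ts IH.
have [N NP] : exists N, forall n, (N <= n)%N -> forall T, T \in Ts ->
    trunc_weight n T =
    \prod_(t' <- subtrees T) (h t' * s (root_type t') (root_word t')).
  elim: Ts IH => [|T Ts IHTs] IH; first by exists 0%N.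
  have [N1 N1P] := IH T (mem_head _ _).
  have [|N2 N2P] := IHTs; first by move=> T' T'Ts; apply: IH; rewrite inE T'Ts orbT.
  exists (maxn N1 N2) => n; rewrite geq_max => /andP[n1 n2] T'.
  by rewrite inE => /orP[/eqP ->|]; [exact: N1P|exact: N2P].
exists N.+1 => -[//|n] Nn.
rewrite prod_subtrees /= mulrA; congr (_ * _).
by apply: eq_big_seq => T TTs; rewrite NP.
Qed.

Lemma trunc_weight_stable_seq (K : seq (ftree G)) : exists n, {in K, forall t,
  trunc_weight n t =
  \prod_(t' <- subtrees t) (h t' * s (root_type t') (root_word t'))}.
Proof.
suff [N NP] : exists N, forall n, (N <= n)%N -> {in K, forall t,
    trunc_weight n t =
    \prod_(t' <- subtrees t) (h t' * s (root_type t') (root_word t'))}.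
  by exists N; apply: NP.
elim: K => [|t K [N2 N2P]]; first by exists 0%N.
have [N1 N1P] := trunc_weight_stable t.
exists (maxn N1 N2) => n; rewrite geq_max => /andP[n1 n2] T'.
by rewrite inE => /orP[/eqP ->|]; [exact: N1P|exact: N2P].
Qed.

End truncation.

Lemma node_sum_le1 (g : ftree G -> R) i K :
  (forall t, 0 <= g t) ->
  (forall i K, uniq K -> {in K, forall t, root_type t = i} ->
    \sum_(t <- K) g t <= 1) ->
  uniq K -> {in K, forall t, root_type t = i} ->
  \sum_(t <- K) s (root_type t) (root_word t) * \prod_(T <- children t) g T <= 1.
Proof.
move=> g0 g1 uK Ki.
under eq_big_seq => t tK do rewrite Ki//.
apply: le_trans (node_sum_le g0 (c := fun=> 1) g1 uK Ki) _.
by under eq_bigr => w _ do rewrite big1// mulr1; rewrite s1// undup_uniq.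
Qed.

Lemma tree_weight_sum_le1 i K : uniq K -> {in K, forall t, root_type t = i} ->
  \sum_(t <- K) tree_weight t <= 1.
Proof.
(* With [g0 = 0], [X n] is the weight restricted to trees of height less than [n], so the induction
   on [n] starts from an empty mass. *)
pose X := trunc_weight (fun=> 1) (fun=> 0).
have X0 n t : 0 <= X n t by exact: trunc_weight_ge0.
have X1 n : forall i K, uniq K -> {in K, forall t, root_type t = i} ->
    \sum_(t <- K) X n t <= 1.
  elim: n => [|n IH] {}i {}K uK Ki; first by rewrite big1.
  rewrite /X /=; under eq_bigr => t _ do rewrite mul1r.
  exact: (node_sum_le1 (X0 n) IH uK Ki).
move=> uK Ki.
have [n nP] := trunc_weight_stable_seq (fun=> 1) (fun=> 0) K.
rewrite (le_trans _ (X1 n i K uK Ki))// le_eqVlt; apply/orP; left; apply/eqP.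
apply: eq_big_seq => t tK; rewrite /X nP//.
by apply: eq_bigr => t' _; rewrite mul1r.
Qed.

Lemma tree_weight_le1 t : tree_weight t <= 1.
Proof.
have := @tree_weight_sum_le1 (root_type t) [:: t]; rewrite big_seq1; apply => //.
by move=> t'; rewrite inE => /eqP ->.
Qed.

Lemma subtrees_size t t' : t' \in subtrees t ->
  (size (subtrees t') <= size (subtrees t))%N.
Proof.
elim/ftree_mem_ind: t => i Ts IH.
rewrite [subtrees (FNode i Ts)]/= inE => /orP[/eqP ->//|].
move=> /flattenP[l /mapP[T TTs ->] /(IH _ TTs) /leq_trans]; apply => /=.
rewrite size_flatten /shape -map_comp leqW// sumnE big_map.
by rewrite (perm_big _ (perm_to_rem TTs)) big_cons leq_addr.
Qed.

(** Otherwise a child would have at least as many vertices as the whole tree. *)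
Lemma notin_subtrees_children i Ts T : T \in Ts -> FNode i Ts \notin subtrees T.
Proof.
move=> TTs; apply/negP => /subtrees_size; apply/negP; rewrite -ltnNge /=.
rewrite size_flatten /shape -map_comp ltnS sumnE big_map.
by rewrite (perm_big _ (perm_to_rem TTs)) big_cons leq_addr.
Qed.

Lemma children_subtrees t T t' :
  T \in children t -> t' \in subtrees T -> t' \in subtrees t.
Proof.
case: t => i Ts /= TTs t'T; rewrite inE; apply/orP; right.
by apply/flattenP; exists (subtrees T) => //; apply: map_f.
Qed.

Section exponential_moment.
Variables (T : ftree G) (a : R).
Let p := tree_weight T.
Let b := 1 - p * (a - 1).
Let kappa := root_type T.
Hypothesis a0 : 0 <= a.
Hypothesis b0 : 0 <= b.

(** The product of [h] over all vertices is [a ^ N * b ^ n]. Below, [X n] takes these factors at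
    depth less than [n] only. *)
Let h t : R := a ^+ (t == T) * b ^+ (root_type t == kappa).
Let X := trunc_weight h tree_weight.

Let h0 t : 0 <= h t.
Proof. by rewrite mulr_ge0 ?exprn_ge0. Qed.

Let X0 n t : 0 <= X n t.
Proof. by apply: trunc_weight_ge0 => // ?; exact: tree_weight_ge0. Qed.

Let p0 : 0 <= p.
Proof. exact: tree_weight_ge0. Qed.

Let tree_weightE t : tree_weight t =
  s (root_type t) (root_word t) * \prod_(T' <- children t) tree_weight T'.
Proof. by case: t => i Ts; exact: tree_weight_node. Qed.

(* Away from [T], only the factors [b] matter, and [b - 1] and [a - 1] have
   opposite signs. *)
Let X_le n t : 1 <= a -> T \notin subtrees t -> X n t <= tree_weight t.
Proof.
move=> a1; have b1 : b <= 1 by rewrite /b gerBl mulr_ge0// subr_ge0.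
elim: n t => [//|n IH] t Tt; rewrite /X /= tree_weightE -[leRHS]mul1r.
have tT : (t == T) = false by apply: contraNF Tt => /eqP ->; exact: root_mem_subtrees.
apply: ler_pM => //; first by rewrite mulr_ge0 ?prodr_ge0.
  by rewrite /h tT mul1r; case: (_ == _).
rewrite ler_wpM2l//; apply: ler_prod_seq => T' T't; rewrite X0 IH//.
by apply: contra Tt; exact: children_subtrees.
Qed.

Let X_ge n t : a <= 1 -> T \notin subtrees t -> tree_weight t <= X n t.
Proof.
move=> a1; have b1 : 1 <= b by rewrite /b lerBrDr gerDl mulr_ge0_le0// subr_le0.
elim: n t => [//|n IH] t Tt; rewrite /X /= tree_weightE -[leLHS]mul1r.
have tT : (t == T) = false by apply: contraNF Tt => /eqP ->; exact: root_mem_subtrees.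
apply: ler_pM => //.
  by rewrite mulr_ge0 ?prodr_ge0// => ? _; exact: tree_weight_ge0.
  by rewrite /h tT mul1r; case: (_ == _).
rewrite ler_wpM2l//; apply: ler_prod_seq => T' T't; rewrite tree_weight_ge0 IH//.
by apply: contra Tt; exact: children_subtrees.
Qed.

(** No copy of [T] occurs strictly below its root, so [X_le] or [X_ge] compares the children with
    their plain weights. Multiplying by [a - 1], of either sign, gives an upper bound in both
    cases. *)
Let gain n : (a - 1) * (b * (s kappa (root_word T) * \prod_(T' <- children T) X n T'))
  <= p * (a - 1).
Proof.
have TT' T' : T' \in children T -> T \notin subtrees T'.
  by rewrite /p; case: (T) => i Ts /= ; exact: notin_subtrees_children.
rewrite [p * _]mulrC /p tree_weightE -/kappa.
have [a1|/ltW a1] := leP 1 a.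
  have b1 : b <= 1 by rewrite /b gerBl mulr_ge0// subr_ge0.
  rewrite ler_wpM2l ?subr_ge0// -[leRHS]mul1r ler_pM//.
    by rewrite mulr_ge0 ?prodr_ge0.
  rewrite ler_wpM2l//; apply: ler_prod_seq => T' T't; rewrite X0 X_le//; exact: TT'.
have b1 : 1 <= b by rewrite /b lerBrDr gerDl mulr_ge0_le0// subr_le0.
rewrite ler_wnM2l ?subr_le0// -[leLHS]mul1r ler_pM//.
  by rewrite mulr_ge0 ?prodr_ge0// => ? _; exact: tree_weight_ge0.
rewrite ler_wpM2l//; apply: ler_prod_seq => T' T't.
rewrite tree_weight_ge0 X_ge//; exact: TT'.
Qed.

Let X_sum_le1 n i K : uniq K -> {in K, forall t, root_type t = i} ->
  \sum_(t <- K) X n t <= 1.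
Proof.
elim: n i K => [|n IH] i K uK Ki; first exact: (tree_weight_sum_le1 uK Ki).
(* A root of another type carries the factor 1, and the induction hypothesis applies directly. *)
have [ik|/negbTE ik] := eqVneq i kappa; last first.
  rewrite (eq_big_seq
    (fun t => s (root_type t) (root_word t) * \prod_(T <- children t) X n T)).
    exact: (node_sum_le1 (X0 n) IH uK Ki).
  move=> t tK; rewrite /X /= /h Ki// ik.
  rewrite (_ : t == T = false) ?mul1r//; apply/negbTE/eqP => tT.
  by move: ik; rewrite -(Ki _ tK) tT eqxx.
(* When [a < 1] the term of [T] is what compensates [b >= 1], so [T] must be in the list. Adding it
   only increases the sum. *)
pose K' := if T \in K then K else T :: K.
have uK' : uniq K' by rewrite /K'; case: ifPn => //= ->.
have K'i : {in K', forall t, root_type t = kappa}.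
  rewrite /K' -ik; case: ifPn => // _ t; rewrite inE => /orP[/eqP ->|/Ki//].
  by rewrite ik.
have TK' : T \in K' by rewrite /K'; case: ifPn => // _; rewrite mem_head.
have sub : {subset K <= K'}.
  by rewrite /K'; case: ifPn => _ t tK //; rewrite inE tK orbT.
apply: le_trans (sum_le_subseq (X0 n.+1) uK sub) _.
(* Every tree contributes [b * Y t], and [T] alone has the correction [(a - 1) * (b * Y T)]. The
   total is at most [b + p * (a - 1) = 1] by [gain]. *)
pose Y t := s (root_type t) (root_word t) * \prod_(T' <- children t) X n T'.
rewrite (eq_big_seq
  (fun t => b * Y t + (t == T)%:R * ((a - 1) * (b * Y T)))); last first.
  move=> t tK'; rewrite /X /= -/X -/(Y t) /h (K'i _ tK') eqxx.
  have [->|_] := eqVneq t T; rewrite /= ?expr1 ?expr0; first by ring.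
  by rewrite !mul1r mul0r addr0.
rewrite big_split /= -mulr_sumr.
have -> : \sum_(t <- K') (t == T)%:R * ((a - 1) * (b * Y T)) = (a - 1) * (b * Y T).
  rewrite (bigD1_seq T)//= eqxx mul1r big1 ?addr0// => t /negbTE ->.
  by rewrite mul0r.
have := gain n; rewrite -[s kappa _ * _]/(Y T) => gn.
have := ler_wpM2l b0 (node_sum_le1 (X0 n) IH uK' K'i); rewrite mulr1 -/Y => bn.
apply: le_trans (lerD bn gn) _.
by rewrite /b; lra.
Qed.

Lemma exponential_moment i K : uniq K -> {in K, forall t, root_type t = i} ->
  \sum_(t <- K) tree_weight t * (a ^+ nb_sub T t * b ^+ nb_root kappa t) <= 1.
Proof.
move=> uK Ki; have [n nP] := trunc_weight_stable_seq h tree_weight K.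
apply: le_trans (X_sum_le1 n uK Ki); rewrite le_eqVlt; apply/orP; left; apply/eqP.
apply: eq_big_seq => t tK; rewrite /X nP// big_split /= mulrC; congr (_ * _).
by rewrite /h big_split /= -!expr_sum -!big_mkcond/= !sum1_count.
Qed.

End exponential_moment.

End weights.

(** * Deviation bounds for fringe counts, and deficient types *)

Section more_weights.
Variables (R : realType) (G : pcountType) (s : G -> seq G -> R).
Hypothesis s0 : forall i w, 0 <= s i w.
Hypothesis s1 : forall i K, uniq K -> \sum_(w <- K) s i w <= 1.
Implicit Types (t T : ftree G) (Ts : seq (ftree G)) (i j : G).

Let q := tree_weight s.
Let q0 t : 0 <= q t. Proof. exact: tree_weight_ge0. Qed.

Section deviation.
Variables (al : G -> R).
Hypothesis al0 : forall i, 0 <= al i.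
Hypothesis al1 : forall K, uniq K -> \sum_(i <- K) al i <= 1.

Lemma root_sum_le1 (g : ftree G -> R) K :
  (forall i K, uniq K -> {in K, forall t, root_type t = i} ->
    \sum_(t <- K) g t <= 1) ->
  uniq K -> \sum_(t <- K) al (root_type t) * g t <= 1.
Proof.
move=> g1 uK; apply: le_trans (sum_fibers_le (c := fun=> 1) al0 _) _ => [i|].
  rewrite -big_filter; apply: (g1 i); first exact: seq.filter_uniq.
  by move=> t; rewrite mem_filter => /andP[/eqP].
by under eq_bigr do rewrite mulr1; rewrite al1// undup_uniq.
Qed.

(** Chernoff bound with [a = 1 + z] and [b = 1 - q T * z]. By [expR_le1D], [a ^ N * b ^ n] is at
    least the exponential of [z * (N - q T * n)] minus quadratic terms. *)
Lemma one_sided_sum_le T (z e m : R) K : `|z| <= 2^-1 -> 0 <= e -> uniq K ->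
  {in K, forall t, m <= (nb_root (root_type T) t)%:R /\
    e * (nb_root (root_type T) t)%:R <=
      z * ((nb_sub T t)%:R - q T * (nb_root (root_type T) t)%:R)
      - 4 * z ^+ 2 * (nb_root (root_type T) t)%:R} ->
  \sum_(t <- K) al (root_type t) * q t <= expR (- (e * m)).
Proof.
move=> z2 e0 uK Kdev.
have p0 : 0 <= q T := q0 T.
have p1 : q T <= 1 by exact: tree_weight_le1.
have /andP[zl zr] : - 2^-1 <= z <= 2^-1 by rewrite -ler_norml.
set k := root_type T in Kdev.
pose b := 1 - q T * (1 + z - 1).
have zz : 1 + z - 1 = z by ring.
have pz : `|q T * z| <= 2^-1.
  by rewrite normrM ger0_norm// (le_trans _ z2)// ler_piMl.
have /andP[pzl pzr] : - 2^-1 <= q T * z <= 2^-1 by rewrite -ler_norml.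
have a0 : 0 <= 1 + z by lra.
have b0 : 0 <= b by rewrite /b zz; lra.
have moment := @exponential_moment _ _ _ s0 s1 T (1 + z) a0 b0.
have Z_ge t : t \in K -> expR (e * m) <= (1 + z) ^+ nb_sub T t * b ^+ nb_root k t.
  move=> /Kdev[mk]; set N := nb_sub T t; set n := nb_root k t => dev.
  have Nn : N%:R <= n%:R :> R by rewrite ler_nat nb_sub_le.
  have le_a : expR (z - 2 * z ^+ 2) ^+ N <= (1 + z) ^+ N.
    by rewrite lerXn2r ?nnegrE ?expR_ge0// expR_le1D.
  have le_b : expR (- (q T * z) - 2 * (q T * z) ^+ 2) ^+ n <= b ^+ n.
    rewrite lerXn2r ?nnegrE ?expR_ge0// /b zz.
    have := @expR_le1D _ (- (q T * z)); rewrite sqrrN; apply; lra.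
  apply: le_trans (ler_pM _ _ le_a le_b); rewrite ?exprn_ge0 ?expR_ge0//.
  rewrite -!expRM_natl -expRD ler_expR.
  have em : e * m <= e * n%:R by rewrite ler_wpM2l.
  have z20 : 0 <= z ^+ 2 := sqr_ge0 z.
  have Nz : N%:R * z ^+ 2 <= n%:R * z ^+ 2 by rewrite ler_wpM2r.
  have pz2 : n%:R * (q T * z) ^+ 2 <= n%:R * z ^+ 2.
    by rewrite ler_wpM2l// exprMn ler_piMl// expr_le1.
  apply: le_trans em (le_trans dev _); rewrite -subr_ge0.
  (* The quadratic losses of [le_a] and [le_b] are each at most [2 * z ^+ 2 * n], because [N <= n]
     and [q T <= 1]; hence the constant 4. *)
  rewrite [X in 0 <= X](_ : _ = 2 * (n%:R * z ^+ 2 - N%:R * z ^+ 2) +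
    2 * (n%:R * z ^+ 2 - n%:R * (q T * z) ^+ 2)); last by ring.
  by rewrite addr_ge0// mulr_ge0// subr_ge0.
(* Markov's inequality: divide the moment bound by the lower bound [Z_ge]. *)
rewrite expRN -[leRHS]mul1r -ler_pdivrMr ?invr_gt0 ?expR_gt0// invrK mulr_suml.
apply: le_trans (root_sum_le1 moment uK).
rewrite big_seq [leRHS]big_seq; apply: ler_sum => t tK.
by rewrite -mulrA ler_wpM2l// ler_wpM2l// Z_ge.
Qed.

(** Each sign of the deviation is handled by [z = eps / 8] or its opposite, whence the factor 2. The
    exponent is [eps ^+ 2 / 8 - 4 * (eps / 8) ^+ 2 = eps ^+ 2 / 16]. *)
Lemma deviation_sum_le T (eps m : R) K : 0 < eps -> eps <= 1 -> uniq K ->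
  {in K, forall t, m <= (nb_root (root_type T) t)%:R /\
    eps * (nb_root (root_type T) t)%:R <=
      `|(nb_sub T t)%:R - q T * (nb_root (root_type T) t)%:R|} ->
  \sum_(t <- K) al (root_type t) * q t <= 2 * expR (- (eps ^+ 2 / 16 * m)).
Proof.
move=> eps0 eps1 uK Kdev.
pose D t : R := (nb_sub T t)%:R - q T * (nb_root (root_type T) t)%:R.
have x2 : `|eps / 8| <= 2^-1 by rewrite ger0_norm; lra.
have e0 : 0 <= eps ^+ 2 / 16 by rewrite mulr_ge0 ?sqr_ge0.
have sided (P : pred (ftree G)) (z : R) : `|z| <= 2^-1 -> z ^+ 2 = (eps / 8) ^+ 2 ->
    (forall t, P t -> z * D t = eps / 8 * `|D t|) ->
    \sum_(t <- K | P t) al (root_type t) * q t <= expR (- (eps ^+ 2 / 16 * m)).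
  move=> z2 zeps PD; rewrite -big_filter.
  apply: (one_sided_sum_le (T := T) z2 e0); first exact: seq.filter_uniq.
  move=> t; rewrite mem_filter => /andP[Pt /Kdev[mt dev]]; split=> //.
  rewrite -[z * _]/(z * D t) PD// zeps; move: dev; rewrite -[X in `|X|]/(D t).
  have : 0 <= (nb_root (root_type T) t)%:R :> R by [].
  move: (nb_root _ _)%:R `|D t| => n d n0 dev.
  have := ler_wpM2l (ltW eps0) dev; lra.
rewrite (bigID (fun t => 0 <= D t))/= mulr2n mulrDl mul1r lerD//.
  by apply: (sided _ (eps / 8)) => // t Dt; rewrite ger0_norm.
apply: (sided _ (- (eps / 8))); rewrite ?normrN ?sqrrN// => t; rewrite -ltNge => Dt.
by rewrite ltr0_norm// mulrN mulNr.
Qed.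

End deviation.

(** After adding [y0] to the list, the factor [c y0] removes [f y0 * (1 - c y0)] from a mass at most
    1, and the other factors only decrease it. *)
Lemma sum_defect_le (Y : eqType) (f c : Y -> R) (y0 : Y) (W : seq Y) :
  (forall y, 0 <= f y) -> (forall W, uniq W -> \sum_(y <- W) f y <= 1) ->
  (forall y, 0 <= c y <= 1) -> uniq W ->
  \sum_(y <- W) f y * c y <= 1 - f y0 * (1 - c y0).
Proof.
move=> f0 f1 c01 uW.
pose W' := if y0 \in W then W else y0 :: W.
have uW' : uniq W' by rewrite /W'; case: ifPn => //= ->.
have y0W' : y0 \in W' by rewrite /W'; case: ifPn => // _; rewrite mem_head.
have sub : {subset W <= W'}.
  by rewrite /W'; case: ifPn => _ y yW //; rewrite inE yW orbT.
apply: le_trans (sum_le_subseq _ uW sub) _.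
  by move=> y; rewrite mulr_ge0//; case/andP: (c01 y).
apply: le_trans (lerB (f1 _ uW') (lexx _)).
rewrite (bigD1_seq y0)//= [X in _ <= X - _](bigD1_seq y0)//=.
rewrite [leRHS](_ : _ = f y0 * c y0 + \sum_(y <- W' | y != y0) f y); last by ring.
rewrite lerD2l.
by apply: ler_sum => y _; rewrite ler_piMr//; case/andP: (c01 y).
Qed.

(** A deficient type has a positive probability of producing an infinite tree. *)
Definition deficient i := exists2 c, c < 1 &
  forall K, uniq K -> {in K, forall t, root_type t = i} -> \sum_(t <- K) q t <= c.

(** Deficiency as a bound on all types at once, equal to 1 away from [j], the form needed to sum
    over words or root types. *)
Let deficiency j : deficient j -> exists2 c : G -> R, (forall i, 0 <= c i <= 1) &
  c j < 1 /\ forall i K, uniq K -> {in K, forall t, root_type t = i} ->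
    \sum_(t <- K) q t <= c i.
Proof.
case=> c c1 cK; exists (fun i => if i == j then c else 1) => [i|].
  case: ifP => _; rewrite ?ler01 ?lexx// (ltW c1) andbT.
  by rewrite (le_trans _ (cK [::] _ _))// big_nil.
split=> [|i K uK]; first by rewrite eqxx.
by case: eqP => [->|_]; [exact: cK|exact: tree_weight_sum_le1].
Qed.

(** A word of positive probability containing [j] has a product of bounds below 1, and
    [sum_defect_le] turns this into a defect for [i]. *)
Lemma deficient_parent i Ts j : 0 < s i (map (@root_type G) Ts) ->
  j \in map (@root_type G) Ts -> deficient j -> deficient i.
Proof.
set w0 := map _ Ts => sw0 jw0 /deficiency[c c01 [cj cK]].
pose C (w : seq G) := \prod_(k <- w) c k.
have C01 w : 0 <= C w <= 1.
  rewrite prodr_ge0/=; last by move=> k _; case/andP: (c01 k).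
  by apply: prodr_ile1 => k _; exact: c01.
have Cw0 : C w0 < 1.
  rewrite /C (perm_big _ (perm_to_rem jw0)) big_cons -/(C (rem j w0)).
  apply: le_lt_trans cj; rewrite ler_piMr//; first by case/andP: (c01 j).
  by case/andP: (C01 (rem j w0)).
exists (1 - s i w0 * (1 - C w0)); first by rewrite ltrBlDr ltrDl mulr_gt0// subr_gt0.
move=> K uK Ki.
have uW := undup_uniq (map (@root_word G) K).
apply: le_trans (sum_defect_le w0 (s0 i) (s1 i) C01 uW).
apply: le_trans (node_sum_le s0 q0 cK uK Ki).
rewrite le_eqVlt; apply/orP; left; apply/eqP; apply: eq_big_seq => -[k Us] kK.
by rewrite /q tree_weight_node -[in RHS](Ki _ kK).
Qed.

(** Deficiency climbs from [t'] to the root, since every offspring word of [t] has positive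
    probability. *)
Lemma deficient_subtree t t' : 0 < q t -> t' \in subtrees t ->
  deficient (root_type t') -> deficient (root_type t).
Proof.
elim/ftree_mem_ind: t => i Ts IH qt; rewrite [subtrees _]/= inE => /orP[/eqP ->//|].
move=> /flattenP[l /mapP[T TTs ->] t'T] def.
move: qt; rewrite /q tree_weight_node.
have [s_gt0|s_le0] := ltP 0 (s i (map (@root_type G) Ts)); last first.
  have -> : s i (map (@root_type G) Ts) = 0 by apply/eqP; rewrite eq_le s_le0 s0.
  by rewrite mul0r ltxx.
rewrite pmulr_rgt0// (perm_big _ (perm_to_rem TTs)) big_cons => qT.
apply: (deficient_parent s_gt0 (map_f _ TTs)); apply: IH t'T def => //.
rewrite lt_neqAle eq_sym q0 andbT; apply: contraTneq qT => qT0.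
by rewrite /= -/(q T) qT0 mul0r ltxx.
Qed.

Lemma deficient_root (al : G -> R) i : (forall i, 0 <= al i) ->
  (forall K, uniq K -> \sum_(i <- K) al i <= 1) -> 0 < al i -> deficient i ->
  exists2 c, c < 1 & forall K, uniq K -> \sum_(t <- K) al (root_type t) * q t <= c.
Proof.
move=> al0 al1 ali /deficiency[c c01 [ci cK]].
exists (1 - al i * (1 - c i)); first by rewrite ltrBlDr ltrDl mulr_gt0// subr_gt0.
move=> K uK.
apply: le_trans (sum_defect_le i al0 al1 c01 (undup_uniq (map (@root_type G) K))).
apply: sum_fibers_le => // j; rewrite -big_filter; apply: cK.
  exact: seq.filter_uniq.
by move=> t; rewrite mem_filter => /andP[/eqP].
Qed.

End more_weights.

(** * The law of a branching tree *)

Section disjoint_events.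
Context d (Omega : measurableType d) (R : realType) (P : probability Omega R).

Lemma prob_disjoint_seq (X : choiceType) (F : X -> set Omega) (K : seq X) :
  (forall x, measurable (F x)) ->
  (forall x y omega, F x omega -> F y omega -> x = y) -> uniq K ->
  \sum_(x <- K) fine (P (F x)) = fine (P (\big[setU/set0]_(x <- K) F x)).
Proof.
move=> mF dF; elim: K => [|x K IH]; first by rewrite !big_nil measure0.
move=> /= /andP[xK uK]; rewrite !big_cons IH// measureU//.
- by rewrite fineD// fin_num_measure//; exact: bigsetU_measurable.
- exact: bigsetU_measurable.
- apply/seteqP; split=> // omega [Fx].
  rewrite -bigcup_seq => -[y /= yK /(dF _ _ _ Fx) xy].
  by move: xK; rewrite xy yK.
Qed.

Lemma prob_disjoint_le1 (X : choiceType) (F : X -> set Omega) (K : seq X) :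
  (forall x, measurable (F x)) ->
  (forall x y omega, F x omega -> F y omega -> x = y) -> uniq K ->
  \sum_(x <- K) fine (P (F x)) <= 1.
Proof.
move=> mF dF uK; rewrite prob_disjoint_seq//.
have mU : measurable (\big[setU/set0]_(x <- K) F x) by exact: bigsetU_measurable.
by rewrite -lee_fin fineK ?fin_num_measure// probability_le1.
Qed.

Lemma measurable_countable_union (X : countType) (F : X -> set Omega) (B : set X) :
  (forall x, B x -> measurable (F x)) -> measurable (\bigcup_(x in B) F x).
Proof.
move=> mF; rewrite bigcup_mkcond; apply: countable_bigcupT_measurable => [|x].
  exact: countableP.
by case: ifP => // /set_mem/mF.
Qed.

(** Countable subadditivity along an enumeration: each partial sum is a sum over a duplicate-free
    finite list. *)
Lemma prob_countable_union_le (X : countType) (F : X -> set Omega) (B : set X) (c : R) :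
  (forall x, measurable (F x)) ->
  (forall K, uniq K -> {in K, forall x, B x} -> \sum_(x <- K) fine (P (F x)) <= c) ->
  (P (\bigcup_(x in B) F x) <= c%:E)%E.
Proof.
move=> mF Fc.
(* Codes that stand for no element, or for one outside [B], give the empty event. *)
pose H n := if @pickle_inv X n is Some x then if `[<B x>] then F x else set0 else set0.
have mH n : measurable (H n).
  by rewrite /H; case: pickle_inv => // x; case: ifP.
have mU : measurable (\bigcup_(x in B) F x) by exact: measurable_countable_union.
have sub : \bigcup_(x in B) F x `<=` \bigcup_n H n.
  move=> omega [x Bx Fx]; exists (choice.pickle x) => //; rewrite /H.
  by rewrite choice.pickleK_inv asboolT.
apply: le_trans (measure_sigma_subadditive P mH mU sub) _.
apply: lime_le; first exact: is_cvg_nneseries.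
apply: nearW => N.
pose K := [seq x <- pmap (@pickle_inv X) (iota 0 N) | `[<B x>]].
have uK : uniq K.
  by apply/seq.filter_uniq/(pmap_uniq (@choice.pickle_invK X)); exact: iota_uniq.
have KB : {in K, forall x, B x} by move=> x; rewrite mem_filter => /andP[/asboolP].
apply: le_trans (_ : ((\sum_(x <- K) fine (P (F x)))%:E <= _)%E); last first.
  by rewrite lee_fin Fc.
rewrite -sumEFin /K big_filter /index_iota subn0.
elim: (iota 0 N) => [|n l IH]; first by rewrite !big_nil.
rewrite big_cons /= /H; case: (pickle_inv n) => [x|] /=.
  rewrite big_cons; case: ifP => _; first by rewrite fineK ?fin_num_measure// leeD2l.
  by rewrite measure0 add0e.
by rewrite measure0 add0e.
Qed.

End disjoint_events.

(** * Finite labellings come from finite trees *)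

Section finite_gw_trees.
Variable G : pcountType.

Lemma finite_tree_lab (w : seq nat -> G -> seq G) u i :
  finite_tree (tree_from w u i) -> exists t, tree_from w u i = lab t.
Proof.
move=> /finite_fsetP[X XE].
have bound v : tree_from w u i v <> None -> (size v < (\max_(v <- X) size v).+1)%N.
  move=> /eqP vV; have : v \in X by have : [set` X] v by rewrite -XE.
  by move=> vX; rewrite ltnS (perm_big _ (perm_to_rem vX)) big_cons leq_maxl.
(* Induction on a strict bound [n] for the lengths of addresses; for [n = 0] it already fails at the
   root. *)
move: {X XE} (_.+1) bound => n; elim: n u i => [|n IH] u i bound.
  by have := bound [::]; rewrite ltn0 => /(_ _)/notF; case.
have /choice[f fP] : forall k, exists T, forall j, onth (w u i) k = Some j ->
    tree_from w (rcons u k) j = lab T.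
  (* Positions beyond the word receive a dummy tree. *)
  move=> k; case wk : (onth (w u i) k) => [j|]; last by exists (FNode i [::]).
  have [|T TE] := IH (rcons u k) j; last by exists T => _ [<-].
  by move=> v vV; have := bound (k :: v); rewrite /= wk => /(_ vV).
exists (FNode i (mkseq f (size (w u i)))).
apply/funext => -[//|k v] /=; rewrite -map_comp.
have [kw|kw] := ltnP k (size (w u i)); last first.
  by rewrite nth_default ?size_map ?size_iota// onth_default.
rewrite (nth_map 0%N) ?size_iota// nth_iota//= add0n.
have : onth (w u i) k by rewrite onthTE.
by case wk : (onth _ k) => [j|//] _; rewrite (fP k j wk).
Qed.

End finite_gw_trees.

(** * Probability that a branching tree equals a given finite tree *)

Section gw_probability.
Context (R : realType) (G : pcountType)
  d0 (Omega0 : measurableType d0) (Q : probability Omega0 R)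
  (sigma : G -> {RV Q >-> discr (seq G)})
  d (Omega : measurableType d) (P : probability Omega R)
  (alpha : {RV P >-> discr G}) (xi : seq nat -> G -> {RV P >-> discr (seq G)}).
Hypothesis source : gw_source alpha xi sigma.
Implicit Types (t T : ftree G) (i j : G) (u v : seq nat).

Definition offspring_prob i (w : seq G) : R := fine (Q (sigma i @^-1` [set w])).
Definition root_prob i : R := fine (P (alpha @^-1` [set i])).

Let msigma i w : measurable (sigma i @^-1` [set w]).
Proof. by rewrite -[X in measurable X]setTI; exact: (measurable_funPT (sigma i)). Qed.

Let mxi u i w : measurable (xi u i @^-1` [set w]).
Proof. by rewrite -[X in measurable X]setTI; exact: (measurable_funPT (xi u i)). Qed.

Let malpha i : measurable (alpha @^-1` [set i]).
Proof. by rewrite -[X in measurable X]setTI; exact: (measurable_funPT alpha). Qed.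

Lemma offspring_prob_ge0 i w : 0 <= offspring_prob i w.
Proof. exact: fine_ge0. Qed.

Lemma root_prob_ge0 i : 0 <= root_prob i.
Proof. exact: fine_ge0. Qed.

Lemma offspring_prob_sum i K : uniq K -> \sum_(w <- K) offspring_prob i w <= 1.
Proof.
apply: (@prob_disjoint_le1 _ _ _ Q _ (fun w => sigma i @^-1` [set w])) => //.
by move=> w w' omega /= <- <-.
Qed.

Lemma root_prob_sum K : uniq K -> \sum_(i <- K) root_prob i <= 1.
Proof.
apply: (@prob_disjoint_le1 _ _ _ P _ (fun i => alpha @^-1` [set i])) => //.
by move=> w w' omega /= <- <-.
Qed.

Let xi_prob u i w : P (xi u i @^-1` [set w]) = (offspring_prob i w)%:E.
Proof.
by case: source => _ _ /(_ u i [set w]) e; rewrite fineK ?fin_num_measure.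
Qed.

(** The values outside [t] are dummies: only addresses of [t] enter [indices]. *)
Let word_at t u : seq G := if sub t u is Some t' then root_word t' else [::].
Let type_at t u : G := if sub t u is Some t' then root_type t' else root_type t.

Let vertex_event t (o : option (seq nat * G)) : set Omega :=
  if o is Some (u, j) then xi u j @^-1` [set word_at t u]
  else alpha @^-1` [set root_type t].

Let indices t := [seq Some (u, type_at t u) | u <- addresses t].

Let indices_uniq t : uniq (indices t).
Proof. by rewrite map_inj_uniq ?addresses_uniq// => u v []. Qed.

Let vertex_event_prob t :
  (\prod_(o <- indices t) P (vertex_event t o))%E = (tree_weight offspring_prob t)%:E.
Proof.
rewrite big_map; under eq_bigr do rewrite xi_prob.
rewrite prodEFin; congr EFin.
pose g o := if o is Some t' then offspring_prob (root_type t') (root_word t') else 0.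
rewrite /tree_weight -[RHS](big_map Some xpredT g) -sub_addresses big_map.
apply: eq_big_seq => u; rewrite mem_addresses /type_at /word_at /g.
by case: (sub t u).
Qed.

Let intersection_prob t (l : seq (option (seq nat * G))) : uniq l ->
  P [set omega | forall o, o \in l -> vertex_event t o omega] =
  (\prod_(o <- l) P (vertex_event t o))%E.
Proof.
move=> ul; case: source => _ + _ => /(_ [fset o in l]%fset (vertex_event t)) ind.
rewrite (_ : [set _ | _] = \bigcap_(j in [set` [fset o in l]%fset]) vertex_event t j).
  rewrite ind => [|[[u i]|] _]; last 2 first.
  - by exists [set word_at t u]; rewrite ?setTI.
  - by exists [set root_type t]; rewrite ?setTI.
  by apply: perm_big; apply: uniq_perm => // o; rewrite inE.
by apply/seteqP; split=> omega H o => [|ol]; [move=> /=; rewrite inE; exact: H|];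
  apply: H; rewrite /= inE.
Qed.

Let gw_at_indices i t : root_type t = i ->
  [set omega | gw_at xi i omega = lab t] =
  [set omega | forall o, o \in indices t -> vertex_event t o omega].
Proof.
move=> ti; apply/seteqP; split=> omega /=.
  move=> /tree_from_lab[_ tw] _ /mapP[u + ->] /=.
  rewrite mem_addresses /word_at /type_at.
  by case tu : (sub t u) => [t'|//] _; apply: tw.
move=> H; apply/tree_from_lab; split=> // v t' tv.
have /H /= : Some (v, type_at t v) \in indices t.
  by apply: map_f; rewrite mem_addresses tv.
by rewrite /word_at /type_at tv.
Qed.

Lemma gw_at_prob t :
  P [set omega | gw_at xi (root_type t) omega = lab t] =
  (tree_weight offspring_prob t)%:E.
Proof. by rewrite gw_at_indices// intersection_prob// vertex_event_prob. Qed.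

(** Compared with [gw_at_prob], the index [None] adds the event on the root type, independent of all
    offspring words. *)
Lemma gw_prob t :
  P [set omega | gw alpha xi omega = lab t] =
  (root_prob (root_type t) * tree_weight offspring_prob t)%:E.
Proof.
have uN : uniq (None :: indices t).
  by rewrite /= indices_uniq andbT; apply/negP => /mapP[].
have := intersection_prob t uN.
rewrite big_cons vertex_event_prob [P (vertex_event t None)]/=.
rewrite -[P (alpha @^-1` _)]fineK ?fin_num_measure// -EFinM => <-.
congr (P _); apply/seteqP; split=> omega /=; rewrite /gw.
  move=> e; have /= [ti _] := (tree_from_lab _ _ _ _).1 e.
  move=> o; rewrite inE => /orP[/eqP -> /=|]; first exact/esym.
  have : [set omega | gw_at xi (root_type t) omega = lab t] omega by rewrite /= ti.
  by rewrite gw_at_indices//; apply.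
move=> H; have /= -> := H None (mem_head _ _).
rewrite -[_ = _]/([set omega | gw_at xi (root_type t) omega = lab t] omega).
rewrite gw_at_indices// => o ot; apply: H; by rewrite inE ot orbT.
Qed.

Lemma measurable_gw_label v (o : option G) :
  measurable [set omega | gw alpha xi omega v = o].
Proof.
rewrite (_ : [set _ | _] = \bigcup_(i in [set: G])
    (alpha @^-1` [set i] `&` [set omega | gw_at xi i omega v = o])).
  apply: countable_bigcupT_measurable => [|i]; first exact: countableP.
  by apply: measurableI; [exact: malpha|exact: measurable_gw_at_label].
apply/seteqP; split=> omega /=; first by move=> e; exists (alpha omega).
by move=> [i _ [/= <-]].
Qed.

End gw_probability.

(** * Conditioning and discrete integrals *)

Section with_high_probability.
Context d (Omega : measurableType d) (R : realType) (p : nat -> probability Omega R).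

(** Since probabilities are at most 1, the lower bound alone amounts to convergence to 1. *)
Definition whp (A : nat -> set Omega) :=
  forall e : R, 0 < e -> \forall n \near \oo, 1 - e <= fine (p n (A n)).

Lemma whpP (A : nat -> set Omega) : (forall n, measurable (A n)) ->
  whp A <-> (fun n => p n (A n)) @ \oo --> 1%E.
Proof.
move=> mA.
have fA n : p n (A n) \is a fin_num by exact: fin_num_measure.
have A1 n : fine (p n (A n)) <= 1 by rewrite -lee_fin fineK// probability_le1.
split=> [wA|/fine_cvgP[_ /cvgrPdist_le cA] e e0].
  apply/fine_cvgP; split; first exact: nearW.
  apply/cvgrPdist_le => e e0; apply: filterS (wA e e0) => n /= An.
  by rewrite ger0_norm ?subr_ge0// lerBlDr addrC -lerBlDr.
apply: filterS (cA e e0) => n /=.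
by rewrite ger0_norm ?subr_ge0// lerBlDr addrC -lerBlDr.
Qed.

Lemma whp_sub (A B : nat -> set Omega) :
  (forall n, measurable (A n)) -> (forall n, measurable (B n)) ->
  (forall n, A n `<=` B n) -> whp A -> whp B.
Proof.
move=> mA mB AB wA e e0; apply: filterS (wA e e0) => n /le_trans; apply.
by apply: fine_le; rewrite ?fin_num_measure//; apply: le_measure; rewrite ?inE.
Qed.

Lemma whpI (A B : nat -> set Omega) :
  (forall n, measurable (A n)) -> (forall n, measurable (B n)) ->
  whp A -> whp B -> whp (fun n => A n `&` B n).
Proof.
move=> mA mB wA wB e e0; have e2 : 0 < e / 2 by rewrite divr_gt0.
near=> n.
have An : 1 - e / 2 <= fine (p n (A n)) by near: n; exact: wA.
have Bn : 1 - e / 2 <= fine (p n (B n)) by near: n; exact: wB.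
have fin (C : set Omega) : measurable C -> p n C \is a fin_num.
  by move=> ?; exact: fin_num_measure.
have : (p n (~` (A n `&` B n)) <= p n (~` A n) + p n (~` B n))%E.
  by rewrite setCI; apply: measureU2; exact: measurableC.
rewrite !probability_setC//; last exact: measurableI.
rewrite -(fineK (fin _ (mA n))) -(fineK (fin _ (mB n))).
rewrite -(fineK (fin _ (measurableI _ _ (mA n) (mB n)))).
rewrite -!EFinB -EFinD lee_fin; lra.
Unshelve. all: end_near. Qed.

Lemma whp_setT : whp (fun=> setT).
Proof.
by move=> e e0; apply: nearW => n; rewrite probability_setT/= lerBlDr lerDl ltW.
Qed.

Lemma whp_bigcap (X : eqType) (K : seq X) (A : X -> set Omega) :
  (forall x, measurable (A x)) -> {in K, forall x, whp (fun=> A x)} ->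
  measurable [set omega | {in K, forall x, A x omega}] /\
  whp (fun=> [set omega | {in K, forall x, A x omega}]).
Proof.
move=> mA; elim: K => [|x K IH] wA.
  rewrite (_ : [set _ | _] = setT); last by apply/seteqP; split.
  by split; [exact: measurableT|exact: whp_setT].
have [|mK wK] := IH; first by move=> y yK; apply: wA; rewrite inE yK orbT.
rewrite (_ : [set _ | _] = A x `&` [set omega | {in K, forall x, A x omega}]).
  by split; [exact: measurableI|apply: whpI => //; apply: wA; exact: mem_head].
apply/seteqP; split=> omega /=.
  by move=> H; split=> [|y yK]; apply: H; rewrite inE ?eqxx// yK orbT.
by move=> [Ax H] y; rewrite inE => /orP[/eqP ->//|]; exact: H.
Qed.

End with_high_probability.

(** * Conditioning on an event of positive probability *)

Section conditioning.
Context d (Omega : measurableType d) (R : realType) (P : probability Omega R).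

Lemma cond_probabilityE (E : set Omega) (mE : measurable E) A : (0 < P E)%E ->
  cond_probability P mE A = (P (A `&` E) * (fine (P E))^-1%:E)%E.
Proof.
move=> E0; rewrite /cond_probability /= /mnormalize /= /mrestr !setTI.
rewrite gt_eqF//= lt_eqF//.
by rewrite -ge0_fin_numE// fin_num_measure.
Qed.

(** The crude bound by which exponentially small events stay negligible under conditioning on events
    that are not exponentially small. *)
Lemma cond_probability_le (E : set Omega) (mE : measurable E) A : (0 < P E)%E ->
  measurable A -> fine (cond_probability P mE A) <= fine (P A) / fine (P E).
Proof.
move=> E0 mA; rewrite cond_probabilityE// fineM ?fin_num_measure//; last first.
  exact: measurableI.
rewrite ler_wpM2r ?invr_ge0 ?fine_ge0//.
have mAE := measurableI _ _ mA mE.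
by apply: fine_le; rewrite ?fin_num_measure//; apply: le_measure; rewrite ?inE.
Qed.

End conditioning.

(** * Integrals of bounded functions on a countable discrete space *)

Section discrete_integral.
Context (R : realType) (X : pcountType).

Lemma discr_bounded_integrable (mu : probability (discr X) R) (f : discr X -> R)
  (M : R) (A : set (discr X)) : (forall x, `|f x| <= M) -> mu.-integrable A (EFin \o f).
Proof.
move=> fM.
have mA : measurable A by [].
apply: (le_integrable mA (g := fun x => M%:E)).
- by [].
- by move=> x _ /=; rewrite lee_fin (le_trans (fM x))// ler_norm.
- apply/integrableP; split; first by [].
  rewrite integral_cst// lte_mul_pinfty ?lee_fin//.
  by rewrite -ge0_fin_numE// fin_num_measure.
Qed.

Lemma Rintegral_seq (mu : probability (discr X) R) (f : discr X -> R) (M : R)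
  (K : seq X) : (forall x, `|f x| <= M) -> uniq K ->
  (\int[mu]_(x in [set` K]) f x) = \sum_(x <- K) f x * fine (mu [set x]).
Proof.
move=> fM; elim: K => [|x K IH].
  rewrite big_nil (_ : [set` _] = set0) ?Rintegral_set0//.
  by apply/seteqP; split.
move=> /= /andP[xK uK]; rewrite big_cons -IH//.
rewrite (_ : [set` x :: K] = [set x] `|` [set` K]); last first.
  apply/seteqP; split=> y /=; rewrite inE.
    by move=> /orP[/eqP ->|]; [left|right].
  by move=> [->|->]; rewrite ?eqxx ?orbT.
rewrite Rintegral_setU//.
- congr (_ + _); rewrite -Rintegral_cst//; apply: eq_Rintegral => y.
  by rewrite inE => ->.
- exact: discr_bounded_integrable fM.
- apply/disj_setPS => y [/= -> yK]; by rewrite yK in xK.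
Qed.

(** The two bounds leave [mu] a mass at most [2 * e] outside [K]. This costs [2 * e * M], and
    replacing the atoms of [mu] by [g] on [K] costs [e * M]. *)
Lemma Rintegral_approx (mu : probability (discr X) R) (f : discr X -> R) (M e : R)
    (K : seq X) (g : X -> R) : (forall x, `|f x| <= M) -> uniq K ->
    1 - e <= \sum_(x <- K) g x ->
    \sum_(x <- K) `|fine (mu [set x]) - g x| <= e ->
  `|(\int[mu]_x f x) - \sum_(x <- K) f x * g x| <= 3 * e * M.
Proof.
move=> fM uK ge mug.
have M0 : 0 <= M by rewrite (le_trans _ (fM point)).
rewrite -(setUv [set` K]) Rintegral_setU//; last 2 first.
- exact: discr_bounded_integrable fM.
- by apply/disj_setPS => y [].
rewrite (Rintegral_seq mu fM uK) addrAC -sumrB.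
have out : `|\int[mu]_(x in ~` [set` K]) f x| <= 2 * e * M.
  apply: le_trans (le_normr_Rintegral _ _) _ => //.
    exact: discr_bounded_integrable fM.
  apply: (@le_trans _ _ (\int[mu]_(x in ~` [set` K]) M)).
    apply: le_Rintegral => //.
      apply: (@discr_bounded_integrable mu (fun x => `|f x|) M) => x.
      by rewrite normr_id.
    by apply: (@discr_bounded_integrable mu (fun x => M) M) => x; rewrite ger0_norm.
  rewrite Rintegral_cst// mulrC ler_wpM2r//.
  rewrite [X in fine X](_ : _ = (1 - mu [set` K])%E); last exact: probability_setC.
  rewrite fineB ?fin_num_measure//=.
  have -> : fine (mu [set` K]) = \sum_(x <- K) fine (mu [set x]).
    rewrite prob_disjoint_seq//; last by move=> x y w /= -> ->.
    congr (fine (mu _)); rewrite -bigcup_seq; apply/seteqP; split=> y /=.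
      by move=> yK; exists y.
    by move=> [x /= xK ->].
  have : \sum_(x <- K) (g x - fine (mu [set x])) <= e.
    apply: le_trans mug; apply: ler_sum => x _.
    by rewrite distrC ler_norm.
  rewrite sumrB; lra.
apply: le_trans (ler_normD _ _) _.
rewrite (_ : 3 * e * M = e * M + 2 * e * M); last by ring.
rewrite lerD//; apply: le_trans (ler_norm_sum _ _ _) _.
apply: le_trans (_ : \sum_(x <- K) M * `|fine (mu [set x]) - g x| <= _).
  apply: ler_sum => x _; rewrite -mulrBr normrM ler_wpM2r//.
by rewrite -mulr_sumr mulrC ler_wpM2r.
Qed.

End discrete_integral.

(** * Measurability *)

Section random_sets.
Context d (Omega : measurableType d).

(** An event determined by countably many measurable alternatives is the union of the fibres it
    meets. *)
Lemma measurable_countable_valued (C : countType) (c : Omega -> C) (B : set Omega) :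
  (forall x, measurable [set omega | c omega = x]) ->
  (forall omega omega', c omega = c omega' -> B omega -> B omega') -> measurable B.
Proof.
move=> mc Bc.
rewrite (_ : B = \bigcup_(x in [set x | exists2 omega, c omega = x & B omega])
   [set omega | c omega = x]); first exact: measurable_countable_union.
apply/seteqP; split=> omega; first by move=> Bo; exists (c omega) => //; exists omega.
by move=> [_ [omega' <- Bo]] /= e; apply: Bc Bo.
Qed.

Lemma measurable_countable_intersection (C : countType) (F : C -> set Omega) :
  (forall x, measurable (F x)) -> measurable [set omega | forall x, F x omega].
Proof.
move=> mF; rewrite (_ : [set _ | _] = ~` \bigcup_(x in setT) ~` F x).
  apply: measurableC; apply: measurable_countable_union => x _.
  exact: measurableC.
apply/seteqP; split=> omega /=; first by move=> H [x _]; apply.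
by move=> H x; apply: contrapT => Fx; apply: H; exists x.
Qed.

Lemma measurable_map_eq (U C : eqType) (c : U -> Omega -> C) (l : seq U) (m : seq C) :
  (forall u x, measurable [set omega | c u omega = x]) ->
  measurable [set omega | [seq c u omega | u <- l] = m].
Proof.
move=> mc; elim: l m => [|u l IH] [|x m] /=.
- by rewrite (_ : [set _ | _] = setT)//; apply/seteqP; split.
- by rewrite (_ : [set _ | _] = set0)//; apply/seteqP; split.
- by rewrite (_ : [set _ | _] = set0)//; apply/seteqP; split.
rewrite (_ : [set _ | _] =
    [set omega | c u omega = x] `&` [set omega | [seq c u omega | u <- l] = m]).
  exact: measurableI.
by apply/seteqP; split=> omega /= [-> ->].
Qed.

Variables (U : countType) (S : Omega -> set U).
Hypothesis mS : forall u, measurable [set omega | S omega u].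

Lemma measurable_random_set (A : set U) : measurable [set omega | S omega = A].
Proof.
rewrite (_ : [set _ | _] =
    [set omega | forall u, [set omega | S omega u <-> A u] omega]).
  apply: measurable_countable_intersection => u.
  have [Au|Au] := pselect (A u).
    rewrite (_ : [set _ | _] = [set omega | S omega u]) => //.
    apply/seteqP; split=> omega /= => [[_ SA]|Su]; first exact: SA.
    by split.
  rewrite (_ : [set _ | _] = ~` [set omega | S omega u]); first exact: measurableC.
  apply/seteqP; split=> omega /= => [[SA _] Su|nS]; first exact/Au/SA.
  by split.
by apply/seteqP; split=> omega /=; [move=> ->|move=> H; apply/seteqP; split=> u /H].
Qed.

Lemma measurable_finite_random_set : measurable [set omega | finite_set (S omega)].
Proof.
rewrite (_ : [set _ | _] =
    \bigcup_(F in [set: {fset U}]) [set omega | S omega = [set` F]]).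
  by apply: measurable_countable_union => F _; exact: measurable_random_set.
apply/seteqP; split=> omega /=.
  by move=> /finite_fsetP[X SX]; exists X.
by move=> [X _ /= ->]; exact: finite_fset.
Qed.

(** [fset_set] has a default value on infinite sets, so finiteness is recorded next to the equality
    with [F]. *)
Lemma measurable_fset_set (F : {fset U}) :
  measurable [set omega | fset_set (S omega) = F].
Proof.
apply: (@measurable_countable_valued (bool * bool)%type
  (fun omega => (`[< S omega = [set` F] >], `[< finite_set (S omega) >]))).
  move=> [b1 b2].
  have mb (b : bool) (A : set Omega) : measurable A ->
      measurable [set omega | `[< A omega >] = b].
    move=> mA; case: b.
      by rewrite (_ : [set _ | _] = A)//; apply/seteqP; split=> omega /= /asboolP.
    rewrite (_ : [set _ | _] = ~` A); first exact: measurableC.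
    by apply/seteqP; split=> omega /= => [/asboolPn|/asboolPn/negbTE].
  rewrite (_ : [set _ | _] = [set omega | `[< S omega = [set` F] >] = b1] `&`
     [set omega | `[< finite_set (S omega) >] = b2]).
    apply: measurableI; apply: mb; first exact: measurable_random_set.
    exact: measurable_finite_random_set.
  by apply/seteqP; split=> omega /= [-> ->].
move=> omega omega' [e1 e2] /= e.
have [fS|fS] := pselect (finite_set (S omega)).
  suff -> : S omega' = [set` F] by rewrite set_fsetK.
  by apply/asboolP; rewrite -e1; apply/asboolP; rewrite -e fset_setK.
have fS' : ~ finite_set (S omega') by apply/asboolPn; rewrite -e2; apply/asboolPn.
by rewrite -e /fset_set; case: pselect => //; case: pselect.
Qed.

End random_sets.

(** * Measurability of fringe counts and fringe laws of a random tree *)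

Section random_trees.
Context d (Omega : measurableType d) (R : realType) (G : pcountType).
Variable tau : Omega -> ptree G.
Hypothesis mtau : forall v o, measurable [set omega | tau omega v = o].
Implicit Types (T : ftree G) (i : G) (u v : seq nat).

Let mconst (p : Prop) : measurable [set _ : Omega | p].
Proof.
have [pT|pF] := pselect p.
  by rewrite (_ : [set _ | _] = setT)//; apply/seteqP; split.
by rewrite (_ : [set _ | _] = set0)//; apply/seteqP; split.
Qed.

Lemma measurable_fringe_eq u T : measurable [set omega | fringe (tau omega) u = lab T].
Proof.
rewrite (_ : [set _ | _] =
    [set omega | forall v, [set omega | tau omega (u ++ v) = lab T v] omega]).
  exact: measurable_countable_intersection.
apply/seteqP; split=> omega /=; first by move=> e v; rewrite -e.
by move=> e; apply/funext.
Qed.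

Lemma measurable_typed_fset i F :
  measurable [set omega | fset_set (typed_vertices i (tau omega)) = F].
Proof.
apply: (measurable_fset_set (S := fun omega => typed_vertices i (tau omega))) => u.
exact: mtau.
Qed.

Lemma measurable_nb_type i (B : set nat) :
  measurable [set omega | B (nb_type i (tau omega))].
Proof.
apply: (measurable_countable_valued (@measurable_typed_fset i)) => omega omega' e.
by rewrite /= /nb_type e.
Qed.

Lemma measurable_nb_type_fringe i T (B : set (nat * nat)) :
  measurable [set omega | B (nb_fringe T (tau omega), nb_type i (tau omega))].
Proof.
pose S omega := [set u | vertices (tau omega) u /\ fringe (tau omega) u = lab T].
have mS u : measurable [set omega | S omega u].
  rewrite (_ : [set _ | _] = ~` [set omega | tau omega u = None] `&`
      [set omega | fringe (tau omega) u = lab T]).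
    by apply: measurableI; [exact: measurableC|exact: measurable_fringe_eq].
  by apply/seteqP; split=> omega /= [/eqP].
apply: (@measurable_countable_valued _ _ _
  (fun omega => (fset_set (S omega), fset_set (typed_vertices i (tau omega))))).
  move=> [F F'].
  rewrite (_ : [set _ | _] = [set omega | fset_set (S omega) = F] `&`
    [set omega | fset_set (typed_vertices i (tau omega)) = F']).
    by apply: measurableI; [exact: measurable_fset_set|exact: measurable_typed_fset].
  by apply/seteqP; split=> omega /= [-> ->].
by move=> omega omega' [e e'] /=; rewrite /nb_fringe /nb_type -/(S omega) e e'.
Qed.

(** If [T] is the default [point], the event also contains all fringe subtrees that are not
    labellings of a finite tree. *)
Lemma measurable_ftree_of_fringe u T :
  measurable [set omega | ftree_of (fringe (tau omega) u) = T].
Proof.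
pose L T' := [set omega | fringe (tau omega) u = lab T'].
rewrite (_ : [set _ | _] = L T `|`
    (~` (\bigcup_(T' in setT) L T') `&` [set _ | point = T])).
  apply: measurableU; first exact: measurable_fringe_eq.
  apply: measurableI => //; apply: measurableC.
  apply: measurable_countable_union => T' _.
  exact: measurable_fringe_eq.
apply/seteqP; split=> omega /=; last first.
  case=> [->|[nL <-]]; first by rewrite ftree_of_lab.
  by rewrite /ftree_of xgetPN// => T' T'L; apply: nL; exists T'.
have [[T' _ LT']|nL] := pselect ((\bigcup_(T' in setT) L T') omega).
  by rewrite LT' ftree_of_lab => <-; left.
move=> e; right; split=> //; rewrite -e /ftree_of xgetPN// => T' T'L.
by apply: nL; exists T'.
Qed.

(** [fringe_law], as a probability rather than as a point of [prob_space]. *)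
Definition fringe_prob i (t : ptree G) : probability (discr (ftree G)) R :=
  distribution (uniform_vertex R i t) (discr_fun (fun u => ftree_of (fringe t u))).

(** The hypothesis covers both no vertex and infinitely many vertices of type [i]. The mass to
    normalize is then zero or infinite, and the Dirac mass at the root address takes over. *)
Lemma fringe_prob_dummy i (t : ptree G) (A : set (discr (ftree G))) :
  fset_set (typed_vertices i t) = fset0 ->
  fringe_prob i t A =
  dirac (ftree_of (fringe t [::]) : discr (ftree G)) A.
Proof.
move=> t0; rewrite /fringe_prob /distribution /pushforward /= /mnormalize /=.
rewrite /mrestr !setTI.
suff -> : ((counting (typed_vertices i t) : \bar R) == 0%E) ||
    ((counting (typed_vertices i t) : \bar R) == +oo%E) by [].
rewrite /counting; case: asboolP => [ft|]; last by rewrite eqxx orbT.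
by rewrite t0 cardfs0 eqxx.
Qed.

Lemma fringe_prob_counting i (t : ptree G) (A : set (discr (ftree G))) :
  fset_set (typed_vertices i t) <> fset0 ->
  fringe_prob i t A =
  (#|` fset_set [set u | A (ftree_of (fringe t u)) /\ typed_vertices i t u]|%:R
   / (nb_type i t)%:R)%:E.
Proof.
move=> t0.
have ft : finite_set (typed_vertices i t).
  by move: t0; rewrite /fset_set; case: pselect.
rewrite /fringe_prob /distribution /pushforward /= /mnormalize /= /mrestr !setTI.
rewrite {1 2 4}/counting asboolT//= -/(nb_type i t).
have -> : ((nb_type i t)%:R%:E == 0%E :> \bar R) ||
    ((nb_type i t)%:R%:E == +oo%E :> \bar R) = false.
  rewrite orbF eqe pnatr_eq0 /nb_type cardfs_eq0; exact/eqP.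
rewrite EFinM; congr (_ * _)%E.
rewrite /counting asboolT//.
exact: sub_finite_set ft.
Qed.

(** The law depends only on countable data: the selected addresses, the finite trees there, and the
    tree at the root for the dummy case. *)
Lemma fringe_prob_ext i (t t' : ptree G) (A : set (discr (ftree G))) :
  fset_set (typed_vertices i t) = fset_set (typed_vertices i t') ->
  (forall u, u \in fset_set (typed_vertices i t) ->
    ftree_of (fringe t u) = ftree_of (fringe t' u)) ->
  ftree_of (fringe t [::]) = ftree_of (fringe t' [::]) ->
  fringe_prob i t A =
  fringe_prob i t' A.
Proof.
move=> eF ef e0.
have [t0|t0] := eqVneq (fset_set (typed_vertices i t)) fset0.
  by rewrite !fringe_prob_dummy -?eF// e0.
have ft : finite_set (typed_vertices i t).
  by move: t0; rewrite /fset_set; case: pselect; rewrite ?eqxx.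
have ft' : finite_set (typed_vertices i t').
  by move: t0; rewrite eF /fset_set; case: pselect; rewrite ?eqxx.
rewrite !fringe_prob_counting -?eF; [|exact/eqP..].
congr ((_ / _)%:E); last by rewrite /nb_type eF.
congr (#|` fset_set _|%:R); have tt' : typed_vertices i t = typed_vertices i t'.
  by rewrite -(fset_setK ft) eF fset_setK.
have ef' u : typed_vertices i t u -> ftree_of (fringe t u) = ftree_of (fringe t' u).
  by move=> iu; apply: ef; rewrite in_fset_set// inE.
rewrite -tt'; apply/seteqP; split=> u /= [+ iu]; rewrite ef'//.
Qed.

Lemma measurable_fringe_law i (V : set (bounded_continuous (discr (ftree G)) R -> R)) :
  measurable [set omega | V (fun f => \int[fringe_law R i (tau omega)]_x (sval f x))].
Proof.
(* These are the data of [fringe_prob_ext], with values in a countable type; hence [V] can be any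
   set. *)
pose c omega := let F := fset_set (typed_vertices i (tau omega)) in
  (F, [seq ftree_of (fringe (tau omega) u) | u <- F],
   ftree_of (fringe (tau omega) [::])).
apply: (measurable_countable_valued (c := c)).
  move=> [[F l] T].
  rewrite (_ : [set _ | _] =
     [set omega | fset_set (typed_vertices i (tau omega)) = F] `&`
     [set omega | [seq ftree_of (fringe (tau omega) u) | u <- F] = l] `&`
     [set omega | ftree_of (fringe (tau omega) [::]) = T]).
    apply: measurableI; last exact: measurable_ftree_of_fringe.
    apply: measurableI; first exact: measurable_typed_fset.
    apply: (measurable_map_eq (c := fun u omega => ftree_of (fringe (tau omega) u))).
    exact: measurable_ftree_of_fringe.
  apply/seteqP; split=> omega; rewrite /c /=; first by move=> [-> -> ->].
  by move=> [[-> ->] ->].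
move=> omega omega' [eF el e0] /=.
suff -> : (fun f : bounded_continuous (discr (ftree G)) R =>
    \int[fringe_law R i (tau omega)]_x (sval f x)) =
  (fun f => \int[fringe_law R i (tau omega')]_x (sval f x)) by [].
apply/funext => f; congr fine; apply: eq_measure_integral => A _ _.
apply: fringe_prob_ext => //.
by move: el; rewrite -eF => /eq_in_map.
Qed.

Lemma fringe_prob_lab T t : (0 < nb_root (root_type T) t)%N ->
  fringe_prob (root_type T) (lab t) [set T] =
  ((nb_sub T t)%:R / (nb_root (root_type T) t)%:R)%:E.
Proof.
move=> t0; rewrite fringe_prob_counting.
  rewrite nb_type_lab; congr ((_ / _)%:E); congr (_%:R).
  apply: card_set_addresses => u /=; split.
    move=> [+ /typed_vertices_lab[t' tu _]]; rewrite (fringe_lab tu) ftree_of_lab => <-.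
    by exists t'.
  move=> [t' tu /eqP t'T]; rewrite (fringe_lab tu) ftree_of_lab; split=> //.
  by apply/typed_vertices_lab; exists t' => //; rewrite t'T.
move=> e; move: t0; rewrite -nb_type_lab /nb_type e cardfs0; by [].
Qed.

End random_trees.

(** * Conditioned trees *)

Section conditioned_gw_trees.
Context (R : realType) (G : pcountType)
  d0 (Omega0 : measurableType d0) (Q : probability Omega0 R)
  (sigma : G -> {RV Q >-> discr (seq G)})
  d (Omega : measurableType d) (P : probability Omega R)
  (alpha : {RV P >-> discr G}) (xi : seq nat -> G -> {RV P >-> discr (seq G)}).
Hypothesis source : gw_source alpha xi sigma.
Hypothesis as_finite : {ae P, forall omega, finite_tree (gw alpha xi omega)}.
Implicit Types (t T : ftree G) (i j : G) (u v : seq nat) (B : set (ftree G)).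

Let q := tree_weight (offspring_prob sigma).
Let al := root_prob alpha.
Let s0 := offspring_prob_ge0 sigma.
Let s1 := offspring_prob_sum sigma.
Let al0 := root_prob_ge0 alpha.
Let al1 := @root_prob_sum _ _ _ _ _ alpha.
Let alq0 t : 0 <= al (root_type t) * q t := mulr_ge0 (al0 _) (tree_weight_ge0 s0 t).
Let gw_is t : set Omega := [set omega | gw alpha xi omega = lab t].

Definition gw_in B : set Omega :=
  \bigcup_(t in B) [set omega | gw alpha xi omega = lab t].

Let mgw v o : measurable [set omega | gw alpha xi omega v = o].
Proof. exact: measurable_gw_label. Qed.

Let mgw_is t : measurable (gw_is t).
Proof.
rewrite (_ : gw_is t =
    [set omega | forall v, [set omega | gw alpha xi omega v = lab t v] omega]).
  exact: measurable_countable_intersection.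
by apply/seteqP; split=> omega /=; [rewrite /gw_is /= => ->|move=> ?; exact/funext].
Qed.

Lemma measurable_gw_in B : measurable (gw_in B).
Proof. by apply: measurable_countable_union => t _; exact: mgw_is. Qed.

Lemma prob_gw_in_le B (c : R) :
  (forall K, uniq K -> {in K, forall t, B t} ->
    \sum_(t <- K) al (root_type t) * q t <= c) ->
  (P (gw_in B) <= c%:E)%E.
Proof.
move=> Bc; apply: prob_countable_union_le; first exact: mgw_is.
move=> K uK KB; under eq_bigr do rewrite (gw_prob source) /=.
exact: Bc.
Qed.

Lemma prob_gw_infinite : P (~` gw_in setT) = 0.
Proof.
case: as_finite => N [mN N0 sub].
apply: (subset_measure0 (B := N)) => //; first exact/measurableC/measurable_gw_in.
apply: subset_trans sub => omega; apply: contra_not.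
by move=> /finite_tree_lab[t tE]; exists t.
Qed.

Section types.
Hypothesis all_types : forall i,
  (0 < P [set omega | nb_type i (gw alpha xi omega) != 0%N])%E.

(** Some finite tree of positive probability contains type [i]. Deficiency of [i] would climb to its
    root and then to the random root type, so finite trees would have total mass below 1. *)
Lemma not_deficient i : ~ deficient (offspring_prob sigma) i.
Proof.
move=> def.
have [t [tq ti]] : exists t, 0 < al (root_type t) * q t /\ (0 < nb_root i t)%N.
  (* Otherwise finite trees containing type [i] have mass zero, and so have infinite trees, against
     [all_types]. *)
  apply: contrapT => no.
  have := all_types i; rewrite ltNge; apply/negP; rewrite negbK.
  have P0 : (P (gw_in [set t | (0 < nb_root i t)%N]) <= 0)%E.
    apply: prob_gw_in_le => K uK Ki; rewrite big_seq big1// => t tK.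
    apply/eqP; rewrite eq_le alq0 andbT leNgt; apply/negP => tq.
    by apply: no; exists t; split=> //; exact: Ki.
  have mi : measurable [set omega | nb_type i (gw alpha xi omega) != 0%N].
    exact: (measurable_nb_type mgw i [set k | k != 0%N]).
  apply: (@le_trans _ _ (P (gw_in [set t | (0 < nb_root i t)%N] `|` ~` gw_in setT))).
    apply: le_measure; rewrite ?inE//.
      by apply: measurableU; [|apply: measurableC]; exact: measurable_gw_in.
    move=> omega /= nbi; have [[t _ tE]|] := pselect (gw_in setT omega); last by right.
    left; exists t => //=; move: nbi; rewrite tE nb_type_lab lt0n; exact.
  apply: le_trans (measureU2 _ _ _) _; [exact: measurable_gw_in| |].
    exact/measurableC/measurable_gw_in.
  have PT : (P (~` gw_in setT) <= 0)%E by rewrite prob_gw_infinite.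
  by rewrite -[leRHS]adde0; exact: leeD.
have al_gt0 : 0 < al (root_type t).
  by rewrite lt_neqAle al0 andbT; apply: contraTneq tq => <-; rewrite mul0r ltxx.
have q_gt0 : 0 < q t by rewrite -(pmulr_rgt0 _ al_gt0).
have /hasP[t' t't /eqP t'i] : has (fun t' => root_type t' == i) (subtrees t).
  by rewrite has_count.
have := deficient_subtree s0 s1 q_gt0 t't; rewrite t'i => /(_ def).
move=> /(deficient_root s0 s1 al0 al1 al_gt0)[c c1 cK].
have : (P (gw_in setT) <= c%:E)%E by apply: prob_gw_in_le => K uK _; exact: cK.
have := probability_setC P (measurable_gw_in setT); rewrite prob_gw_infinite.
rewrite -(fineK (fin_num_measure P _ (measurable_gw_in setT))) -EFinB lee_fin => -[].
by move=> e le_c; move: c1; rewrite ltNge (le_trans _ le_c)// -subr_le0 -e.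
Qed.

(** Expresses that the tree started at [i] is almost surely finite, through finite lists carrying
    almost all the mass. *)
Lemma tree_weight_exhaust i (e : R) : 0 < e -> exists K,
  [/\ uniq K, {in K, forall t, root_type t = i} & 1 - e <= \sum_(t <- K) q t].
Proof.
move=> e0; apply: contrapT => no; apply: (@not_deficient i).
exists (1 - e); first by rewrite ltrBlDr ltrDl.
move=> K uK Ki; rewrite leNgt; apply/negP => /ltW Ke.
by apply: no; exists K.
Qed.

Lemma gw_law_approx i (f : discr (ftree G) -> R) (M e : R) K :
  (forall x, `|f x| <= M) -> uniq K -> {in K, forall t, root_type t = i} ->
  1 - e <= \sum_(t <- K) q t ->
  `|(\int[gw_law xi i]_x f x) - \sum_(t <- K) f t * q t| <= 3 * e * M.
Proof.
move=> fM uK Ki Ke; apply: Rintegral_approx => //.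
set mu := gw_law _ _.
pose muR : probability (discr (ftree G)) R := mu.
(* Only an inequality is shown, as the dummy value of [ftree_of] might add mass to an atom. The
   total mass 1 then bounds the sum of the differences by [e]. *)
have le_mu t : t \in K -> q t <= fine (mu [set t]).
  move=> tK; rewrite -lee_fin fineK; last exact: (fin_num_measure muR).
  rewrite /q -(gw_at_prob source) (Ki _ tK).
  rewrite /mu /gw_law /distribution /pushforward /=.
  apply: le_measure; rewrite ?inE.
  - exact: measurable_gw_at_eq.
  - rewrite -[X in measurable X]setTI; exact: measurable_gw_at_ftree.
  - by move=> omega /= e'; rewrite /gw_at_ftree e' ftree_of_lab.
rewrite (eq_big_seq (fun t => fine (mu [set t]) - q t)); last first.
  by move=> t tK; rewrite ger0_norm// subr_ge0 le_mu.
rewrite sumrB.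
have : \sum_(t <- K) fine (muR [set t]) <= 1.
  by apply: prob_disjoint_le1 => // x y w /= -> ->.
rewrite -[\sum_(t <- K) fine (muR _)]/(\sum_(t <- K) fine (mu [set t])); lra.
Qed.

End types.

Variables (kappa : G) (E : nat -> set Omega) (mE : forall n, measurable (E n)).
Hypothesis E_gt0 : forall n, (0 < P (E n))%E.
Variable s : nat -> R.
Hypothesis E_large : forall eps : R, 0 < eps ->
  (fun n => expR (- eps * s n)) =o_\oo (fun n => fine (P (E n))).
Hypothesis many_kappa :
  (fun n => cond_probability P (mE n)
    [set omega | s n <= (nb_type kappa (gw alpha xi omega))%:R]) @ \oo --> 1%E.

Let pn n := cond_probability P (mE n).

(** Outside [gw_in B] the tree has fewer than [s n] vertices of type [kappa], or is a finite tree
    covered by the exponential bound with [m = s n], or is infinite. The three cases are negligible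
    by [many_kappa], [E_large] and almost sure finiteness. *)
Lemma whp_gw_in B (c : R) : 0 < c ->
  (forall m K, uniq K ->
    {in K, forall t, m <= (nb_root kappa t)%:R /\ ~ B t} ->
    \sum_(t <- K) al (root_type t) * q t <= 2 * expR (- (c * m))) ->
  whp pn (fun=> gw_in B).
Proof.
move=> c0 Bc e e0.
pose S n := [set omega | s n <= (nb_type kappa (gw alpha xi omega))%:R].
have mS n : measurable (S n).
  exact: (measurable_nb_type mgw kappa [set k | s n <= k%:R]).
have wS : whp pn S by apply/whpP.
have e2 : 0 < e / 2 by rewrite divr_gt0.
(* The error is split into [e / 2] for too few vertices and [2 * (e / 4)] for the exponential
   bound. *)
have e4 : 0 < e / 4 by rewrite divr_gt0.
near=> n.
have Sn : 1 - e / 2 <= fine (pn n (S n)) by near: n; exact: wS.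
have En : `|expR (- c * s n)| <= e / 4 * `|fine (P (E n))|.
  by near: n; move/eqoP : (E_large c0); exact.
pose B' := [set t | s n <= (nb_root kappa t)%:R /\ ~ B t].
have mB := measurable_gw_in B; have mB' := measurable_gw_in B'.
have mT := measurable_gw_in setT.
have fin (A : set Omega) : measurable A -> pn n A \is a fin_num.
  by move=> ?; exact: fin_num_measure.
have PE_gt0 : 0 < fine (P (E n)).
  by rewrite fine_gt0// E_gt0/= -ge0_fin_numE// fin_num_measure.
have B'e : fine (pn n (gw_in B')) <= e / 2.
  apply: le_trans (cond_probability_le _ _ _) _ => //.
  rewrite ler_pdivrMr//; move: En.
  rewrite !ger0_norm ?expR_ge0 ?(ltW PE_gt0)// mulNr => En.
  have : fine (P (gw_in B')) <= 2 * expR (- (c * s n)).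
    by rewrite -lee_fin fineK ?fin_num_measure//; apply: prob_gw_in_le; exact: Bc.
  lra.
have T0 : fine (pn n (~` gw_in setT)) = 0.
  apply/eqP; rewrite eq_le fine_ge0// andbT.
  apply: le_trans (cond_probability_le _ _ _) _ => //; first exact: measurableC.
  by rewrite prob_gw_infinite mul0r.
have cover : (pn n (~` gw_in B) <=
    pn n (~` S n) + pn n (gw_in B') + pn n (~` gw_in setT))%E.
  have mSc := measurableC (mS n); have mTc := measurableC mT.
  apply: (@le_trans _ _ (pn n (~` S n `|` gw_in B' `|` ~` gw_in setT))).
    apply: le_measure; rewrite ?inE.
    - exact: measurableC.
    - by apply: measurableU => //; exact: measurableU.
    move=> omega nB; have [[t _ tE]|] := pselect (gw_in setT omega); last by right.
    have [St|] := pselect (S n omega); last by left; left.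
    left; right; exists t => //; split.
      by move: St; rewrite /S /= tE nb_type_lab.
    by move=> Bt; apply: nB; exists t.
  apply: le_trans (measureU2 _ _ _) _ => //; first exact: measurableU.
  by rewrite leeD2r//; apply: measureU2.
move: cover; rewrite !probability_setC// -(fineK (fin _ mB)) -(fineK (fin _ (mS n))).
rewrite -(fineK (fin _ mB')) -[X in (_ <= _ + X)%E]probability_setC//.
rewrite -(fineK (fin _ (measurableC mT))) T0 -!EFinB -!EFinD lee_fin; lra.
Unshelve. all: end_near. Qed.

Lemma whp_fringe_ratio T (eps : R) : root_type T = kappa -> 0 < eps ->
  whp pn (fun=> gw_in [set t | (0 < nb_root kappa t)%N /\
    `|(nb_sub T t)%:R / (nb_root kappa t)%:R - q T| < eps]).
Proof.
move=> Tk eps0.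
(* [deviation_sum_le] requires a precision at most 1. *)
pose e := Num.min eps 1.
have e0 : 0 < e by rewrite lt_min eps0 ltr01.
have e1 : e <= 1 by rewrite ge_min lexx orbT.
apply: (@whp_gw_in _ (e ^+ 2 / 16)); first by rewrite divr_gt0// exprn_gt0.
move=> m K uK KB; apply: (deviation_sum_le s0 s1 al0 al1 (T := T)) => // t tK.
have [mt nB] := KB _ tK; rewrite Tk; split=> //.
(* A deviation strictly below [e * n] forces [n > 0], so the ratio is meaningful and within
   [eps]. *)
rewrite leNgt; apply/negP => dev; apply: nB.
have t0 : 0 < (nb_root kappa t)%:R :> R.
  by rewrite -(pmulr_rgt0 _ e0) (le_lt_trans _ dev).
split; first by rewrite -(ltr0n R).
rewrite -(ltr_pM2r t0) -{2}(gtr0_norm t0) -normrM mulrBl divfK ?gt_eqF//.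
by rewrite (lt_le_trans dev)// ler_wpM2r ?(ltW t0)// ge_min lexx.
Qed.

Lemma fringe_ratio_cvg T : root_type T = kappa ->
  cvg_in_probability pn
    (fun n omega => (nb_fringe T (gw alpha xi omega))%:R
                    / (nb_type kappa (gw alpha xi omega))%:R : R)
    (fine (P [set omega | gw_at xi kappa omega = lab T])).
Proof.
move=> Tk U Uopen; rewrite -{1}Tk (gw_at_prob source)/= in Uopen.
have /nbhs_ballP[eps /= eps0 epsU] := open_nbhs_nbhs Uopen.
have mU : measurable [set omega | U ((nb_fringe T (gw alpha xi omega))%:R
                    / (nb_type kappa (gw alpha xi omega))%:R : R)].
  exact: (measurable_nb_type_fringe mgw kappa T [set k | U (k.1%:R / k.2%:R)]).
apply/whpP => //.
apply: whp_sub (whp_fringe_ratio Tk eps0) => // [n|n omega].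
  exact: measurable_gw_in.
move=> [t [t0 tT] /= ->]; rewrite nb_fringe_lab nb_type_lab; apply: epsU.
by rewrite /ball /= distrC.
Qed.

Hypothesis all_types : forall i,
  (0 < P [set omega | nb_type i (gw alpha xi omega) != 0%N])%E.

(** A finite list [K] carries almost all of [q], and with high probability the fringe ratios of all
    its trees are close to [q]. Both integrals are then close to the same finite sum. *)
Lemma whp_fringe_integral (f : discr (ftree G) -> R) (M e : R) :
  (forall x, `|f x| <= M) -> 0 < e ->
  exists A : set Omega, [/\ measurable A, whp pn (fun=> A) &
    A `<=` [set omega | `|(\int[gw_law xi kappa]_x f x) -
      \int[fringe_law R kappa (gw alpha xi omega)]_x f x| < e]].
Proof.
move=> fM e0.
have M0 : 0 <= M by rewrite (le_trans _ (fM point)).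
pose M' := M + 1; have M'0 : 0 < M' by rewrite /M'; lra.
have fM' x : `|f x| <= M' by rewrite (le_trans (fM x))// /M'; lra.
(* Each of the two approximations costs [3 * dl * M']; 7 instead of 6 makes the final inequality
   strict. *)
pose dl := e / (7 * M'); have dl0 : 0 < dl by rewrite /dl divr_gt0// mulr_gt0.
have [K [uK Kk Kdl]] := tree_weight_exhaust all_types kappa dl0.
pose eta := dl / (size K).+1%:R; have eta0 : 0 < eta by rewrite divr_gt0.
pose A T := gw_in [set t | (0 < nb_root kappa t)%N /\
  `|(nb_sub T t)%:R / (nb_root kappa t)%:R - q T| < eta].
(* The one-vertex tree is added so that, even for empty [K], the event provides a finite tree with a
   vertex of type [kappa]. *)
pose T0 := FNode kappa [::].
have [||mA wA] := @whp_bigcap _ _ _ pn _ (T0 :: K) A.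
- by move=> T; exact: measurable_gw_in.
- move=> T; rewrite inE => /orP[/eqP ->|/Kk Tk]; exact: whp_fringe_ratio.
exists [set omega | {in T0 :: K, forall T, A T omega}]; split=> // omega /= H.
have [t [t0 _] tE] := H T0 (mem_head _ _).
have Kt T : T \in K -> `|(nb_sub T t)%:R / (nb_root kappa t)%:R - q T| < eta.
  move=> TK; have [|t' [_ t'T] t'E] := H T; first by rewrite inE TK orbT.
  have -> // : t = t' by apply: (@lab_inj G); rewrite -tE -t'E.
rewrite tE.
have approx0 := gw_law_approx fM' uK Kk Kdl.
have approx : `|(\int[fringe_law R kappa (lab t)]_x f x) -
    \sum_(T <- K) f T * q T| <= 3 * dl * M'.
  apply: Rintegral_approx => //.
  apply: (@le_trans _ _ (\sum_(T <- K) eta)); last first.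
    rewrite big_const_seq count_predT iter_addr_0 -[_ *+ size K]mulr_natr.
    rewrite -mulrA ger_pMr//.
    by rewrite ler_pdivrMl// mulr1 ler_nat.
  rewrite big_seq [leRHS]big_seq; apply: ler_sum => T TK.
  have := @fringe_prob_lab R G T t; rewrite (Kk _ TK) => /(_ t0) /= fT.
  by apply/ltW; move: (Kt _ TK); rewrite -[X in X - _]/(fine _%:E) -fT.
have -> : e = 7 * dl * M' by rewrite /dl; field; lra.
rewrite -[X in `|X|](subrKA (\sum_(T <- K) f T * q T)).
apply: le_lt_trans (ler_normD _ _) _.
move: approx; rewrite distrC => approx.
have := mulr_gt0 dl0 M'0; lra.
Qed.

(** Weak neighbourhoods are preimages of neighbourhoods in a product, so it suffices to treat one
    bounded function at a time. *)
Lemma fringe_law_cvg :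
  cvg_in_probability pn (fun n omega => fringe_law R kappa (gw alpha xi omega))
    (gw_law xi kappa).
Proof.
move=> U [[V Vopen <-] UV].
pose Phi omega : {ptws bounded_continuous (discr (ftree G)) R -> R} :=
  fun f => \int[fringe_law R kappa (gw alpha xi omega)]_x (sval f x).
pose x0 : {ptws bounded_continuous (discr (ftree G)) R -> R} :=
  fun f => \int[gw_law xi kappa]_x (sval f x).
have mPhi (W : set {ptws bounded_continuous (discr (ftree G)) R -> R}) :
    measurable [set omega | W (Phi omega)].
  exact: (measurable_fringe_law mgw kappa W).
(* Sets containing [Phi] with high probability form a filter, which turns convergence in probability
   into convergence of a filter. *)
pose F : set_system {ptws bounded_continuous (discr (ftree G)) R -> R} :=
  [set W | whp pn (fun=> [set omega | W (Phi omega)])].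
have FF : Filter F.
  split.
  - exact: whp_setT.
  - by move=> W1 W2 w1 w2; apply: whpI => // n; exact: mPhi.
  - move=> W1 W2 W12; apply: whp_sub => [n|n|n omega]; last exact: W12.
      exact: mPhi.
    exact: mPhi.
apply/whpP => [n|]; first exact: (mPhi V).
suff Fx0 : F --> x0 by apply: (Fx0 V); apply: open_nbhs_nbhs.
(* Convergence in the product topology is checked at each coordinate [f]. *)
apply/cvg_sup => f.
apply/cvg_image; first by apply/seteqP; split=> // y _; exists (fun=> y).
move=> W /nbhs_ballP[e /= e0 eW].
exists (fun g => W (g f)).
  case: (f) eW => g [cg [M gM]] /= eW.
  have [A [mA wA AW]] := whp_fringe_integral gM e0.
  apply: whp_sub wA => // [_|_ omega /AW /= ?]; last exact: eW.
  exact: (mPhi (fun h => W (h _))).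
apply/seteqP; split=> [y [g Wg <-]//|y Wy].
by exists (fun=> y).
Qed.

End conditioned_gw_trees.

Unset Implicit Arguments.
Set Strict Implicit.

Theorem lemma1 (R : realType) (G : pcountType)
    (d0 : measure_display) (Omega0 : measurableType d0) (Q : probability Omega0 R)
    (sigma : G -> {RV Q >-> discr (seq G)})
    (d : measure_display) (Omega : measurableType d) (P : probability Omega R)
    (alpha : {RV P >-> discr G})
    (xi : seq nat -> G -> {RV P >-> discr (seq G)})
    (source : gw_source alpha xi sigma)
    (all_types : forall i : G,
      (0 < P [set omega | nb_type i (gw alpha xi omega) != 0%N])%E)
    (as_finite : {ae P, forall omega, finite_tree (gw alpha xi omega)})
    (kappa : G)
    (E : nat -> set Omega) (mE : forall n, measurable (E n))
    (E_gt0 : forall n, (0 < P (E n))%E)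
    (s : nat -> R) (s_oo : s @ \oo --> +oo)
    (E_large : forall eps : R, 0 < eps ->
      (fun n => expR (- eps * s n)) =o_\oo (fun n => fine (P (E n))))
    (many_kappa :
      (fun n => cond_probability P (mE n)
        [set omega | s n <= (nb_type kappa (gw alpha xi omega))%:R]) @ \oo --> 1%E) :
  (forall T : ftree G, root_type T = kappa ->
    cvg_in_probability (fun n => cond_probability P (mE n))
      (fun n omega => (nb_fringe T (gw alpha xi omega))%:R
                      / (nb_type kappa (gw alpha xi omega))%:R : R)
      (fine (P [set omega | gw_at xi kappa omega = lab T])))
  /\
  cvg_in_probability (fun n => cond_probability P (mE n))
    (fun n omega => fringe_law R kappa (gw alpha xi omega))
    (gw_law xi kappa).
Proof.
split=> [T Tk|].
  exact: (fringe_ratio_cvg source as_finite E_gt0 E_large many_kappa Tk).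
exact: (fringe_law_cvg source as_finite E_gt0 E_large many_kappa all_types).
Qed.
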